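(* Let $N\ge1$, $q$ real with $0<|q|<1$, and $0<r<\frac{1-|q|}{|1-q|}$. For the $N$-particle $q$-TAZRP started from $Y=(y_N,\dots,y_1)\in\mathbf{S}$, for every $x\in\mathbb{Z}$ and $t\ge0$, $$\mathbb{P}_Y(x_N(t)=x)=\Big(\frac{1}{2\pi i}\Big)^N\oint_{\mathcal{C}_r}\cdots\oint_{\mathcal{C}_r}I(z_1,\dots,z_N)\prod_{i=1}^N z_i^{x-y_i-1}e^{\epsilon(z_i)t}\,dz_1\cdots dz_N,$$ where $$I(z_1,\dots,z_N)=\prod_{1\le i<j\le N}\frac{z_i-z_j}{z_i-qz_j-(1-q)z_iz_j}\cdot\frac{1-\prod_{i=1}^N z_i}{\prod_{i=1}^N(1-z_i)}$$ and $\epsilon(z)=\frac1z-1$.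
   Context: $[k]_q=1+q+\cdots+q^{k-1}$. $\mathbf{S}=\{(x_N,\dots,x_1)\in\mathbb{Z}^N:x_N\le\cdots\le x_1\}$ is the set of configurations of $N$ indistinguishable particles on $\mathbb{Z}$. The $q$-TAZRP is the continuous-time Markov chain on $\mathbf{S}$ in which, independently for each occupied site $\mathbf{x}$ holding $k$ particles, one particle jumps from $\mathbf{x}$ to $\mathbf{x}+1$ at rate $[k]_q$. $x_N(t)$ denotes the position of the left-most particle at time $t$, and $\mathbb{P}_Y$ the law of the process started at $Y$. $\mathcal{C}_r$ is the positively oriented circle of radius $r$ about $0$. *)

(* Defs.v *)
From Stdlib Require Export Reals ZArith List Sorted Bool.
Export ListNotations.
Open Scope R_scope.

Definition qint (q : R) (k : nat) : R :=
  fold_right Rplus 0 (map (fun j => q ^ j) (seq 0 k)).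

(* A configuration (x_N, ..., x_1) with x_N <= ... <= x_1 is the list
   [x_N; ...; x_1] (nondecreasing).  x_N is its head. *)
Definition in_S (N : nat) (X : list Z) : Prop :=
  length X = N /\ Sorted Z.le X.

(* Possible jumps from X, with rates: at each occupied site s holding k
   particles, one particle jumps s -> s+1 at rate [k]_q.  In the sorted list,
   this is realised by incrementing the LAST entry equal to s (so the list
   stays sorted).  *)
Definition moves (q : R) (X : list Z) : list (R * list Z) :=
  flat_map (fun i =>
    let s := nth i X 0%Z in
    if (Nat.eqb (S i) (length X) || negb (Z.eqb (nth (S i) X 0%Z) s))%bool
    then [(qint q (count_occ Z.eq_dec X s), firstn i X ++ (s + 1)%Z :: skipn (S i) X)]
    else []) (seq 0 (length X)).

Definition total_rate (q : R) (X : list Z) : R :=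
  fold_right Rplus 0 (map fst (moves q X)).

(* A finitely supported signed measure on configurations, as a weighted list
   (repetitions are added). [gen_step] applies the generator Q:
   (mu Q)(X') = sum_X mu(X) Q(X,X'), Q(X,X) = - total rate. *)
Definition gen_step (q : R) (D : list (R * list Z)) : list (R * list Z) :=
  flat_map (fun p : R * list Z => let (w, X) := p in
     (- (w * total_rate q X), X) :: map (fun m => (w * fst m, snd m)) (moves q X)) D.

Definition distn (q : R) (n : nat) (Y : list Z) : list (R * list Z) :=
  Nat.iter n (gen_step q) [(1, Y)].

Definition coef (q : R) (n : nat) (Y : list Z) (x : Z) : R :=
  fold_right Rplus 0
    (map (fun p : R * list Z => if Z.eqb (hd 0%Z (snd p)) x then fst p else 0) (distn q n Y)).

(* P_Y(x_N(t) = x) = (e^{tQ} 1_{x_N = x})(Y) = p : the transition semigroup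
   of the (bounded-rate) q-TAZRP. *)
Definition prob_leftmost (q : R) (Y : list Z) (x : Z) (t p : R) : Prop :=
  infinite_sum (fun n => coef q n Y x * t ^ n / INR (fact n)) p.

Record C := mkC { Re : R; Im : R }.
Definition C0 : C := mkC 0 0.
Definition C1 : C := mkC 1 0.
Definition RtoC (a : R) : C := mkC a 0.
Definition Ci : C := mkC 0 1.
Definition Cadd (z w : C) : C := mkC (Re z + Re w) (Im z + Im w).
Definition Copp (z : C) : C := mkC (- Re z) (- Im z).
Definition Csub (z w : C) : C := Cadd z (Copp w).
Definition Cmul (z w : C) : C :=
  mkC (Re z * Re w - Im z * Im w) (Re z * Im w + Im z * Re w).
Definition Cinv (z : C) : C :=
  let d := Re z ^ 2 + Im z ^ 2 in mkC (Re z / d) (- Im z / d).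
Definition Cdiv (z w : C) : C := Cmul z (Cinv w).
Fixpoint Cpown (z : C) (n : nat) : C :=
  match n with O => C1 | S m => Cmul z (Cpown z m) end.
Definition Cpowz (z : C) (k : Z) : C :=
  if Z.leb 0 k then Cpown z (Z.to_nat k) else Cinv (Cpown z (Z.to_nat (- k))).
Definition Cexp (z : C) : C := mkC (exp (Re z) * cos (Im z)) (exp (Re z) * sin (Im z)).
Definition Cprod (l : list C) : C := fold_right Cmul C1 l.

Inductive iter_int : nat -> (list R -> R) -> R -> Prop :=
| iter_int0 (f : list R -> R) : iter_int 0 f (f nil)
| iter_intS (n : nat) (f : list R -> R) (g : R -> R) (v : R) :
    (forall th, iter_int n (fun l => f (th :: l)) (g th)) ->
    forall pr : Riemann_integrable g 0 (2 * PI), RiemannInt pr = v ->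
    iter_int (S n) f v.

Definition circ (r th : R) : C := mkC (r * cos th) (r * sin th).

(* contour_int n r F v :  oint_{C_r} ... oint_{C_r} F(z_1,...,z_n) dz_1...dz_n = v,
   with z_k = r e^{i th_k}, dz_k = i z_k d th_k, th_k in [0, 2 pi]. *)
Definition contour_int (n : nat) (r : R) (F : list C -> C) (v : C) : Prop :=
  let G := fun ths : list R =>
    Cmul (F (map (circ r) ths)) (Cprod (map (fun th => Cmul Ci (circ r th)) ths)) in
  iter_int n (fun ths => Re (G ths)) (Re v) /\ iter_int n (fun ths => Im (G ths)) (Im v).

(* zs = [z_1; ...; z_N];  z_i = nth (i-1) zs *)
Definition zi (zs : list C) (i : nat) : C := nth (i - 1) zs C0.
(* Y = [y_N; ...; y_1];  y_i = nth (N-i) Y *)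
Definition yi (N : nat) (Y : list Z) (i : nat) : Z := nth (N - i) Y 0%Z.

Definition pairs_lt (N : nat) : list (nat * nat) :=
  flat_map (fun i => map (fun j => (i, j)) (seq (S i) (N - i))) (seq 1 N).

Definition I_fun (N : nat) (q : R) (zs : list C) : C :=
  Cmul
    (Cprod (map (fun ij : nat * nat => let (i, j) := ij in
       Cdiv (Csub (zi zs i) (zi zs j))
            (Csub (Csub (zi zs i) (Cmul (RtoC q) (zi zs j)))
                  (Cmul (RtoC (1 - q)) (Cmul (zi zs i) (zi zs j)))))
       (pairs_lt N)))
    (Cdiv (Csub C1 (Cprod (map (zi zs) (seq 1 N))))
          (Cprod (map (fun i => Csub C1 (zi zs i)) (seq 1 N)))).

Definition eps (z : C) : C := Csub (Cinv z) C1.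

Definition integrand (N : nat) (q : R) (Y : list Z) (x : Z) (t : R) (zs : list C) : C :=
  Cmul (Cpown (Cinv (Cmul (RtoC (2 * PI)) Ci)) N)
   (Cmul (I_fun N q zs)
     (Cprod (map (fun i =>
        Cmul (Cpowz (zi zs i) (x - yi N Y i - 1)%Z)
             (Cexp (Cmul (eps (zi zs i)) (RtoC t)))) (seq 1 N)))).

(* Main.v *)
(* Expanding both sides in powers of t, it suffices to show that
   J_m(Y), the torus average of K(z) (1 - prod z) / prod (1 - z_i) prod z_i^(x - y_i)
   times (sum_i eps z_i)^m, with K the product of the (z_i - z_j) / (z_i - q z_j - (1-q) z_i z_j),
   equals (Q^m 1_{x_N = x})(Y) for the generator Q.
   - Recursion in m: multiplying by eps z_i is the difference of J_m in direction y_i.  When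
     y_i = y_{i+1}, the factor (1/z_{i+1} - q/z_i - (1-q)) cancels the denominator in K and makes
     the integrand antisymmetric in z_i, z_{i+1}; so the successive differences inside a cluster
     of k particles are geometric with ratio q and their sum is [k]_q times the first one.
   - J_0: with G(a) the average of K / prod (1 - z_i) prod z_i^(a_i), one has J_0 = G(a) - G(a+1).
     If a_N >= 1, G(a) = 0 because the integrand is a power series in z_N without constant term.
     If a_1 <= 0, pushing the z_1 contour to infinity leaves the residue at z_1 = 1, where all
     the factors (z_1 - z_j) / (z_1 - q z_j - (1-q) z_1 z_j) equal 1, so z_1 drops out; hence
     G(a) = 1 when all a_i <= 0.
   The choice of r makes all these functions uniform limits of Laurent polynomials on the torus
   |z_i| = r, and averages of those are read off the exponents. *)

From Stdlib Require Import Psatz FunctionalExtensionality Permutation.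
From Stdlib Require IndefiniteDescription.
From Coquelicot Require Import Hierarchy RInt RInt_analysis Derive Lim_seq AutoDerive.
From Coquelicot Require Complex.
Require Import Defs.

(** * Complex numbers *)

(* The condition on r says |q| + |1-q| r < 1. Divided by z_i, the denominator z_i - q z_j - (1-q)
   z_i z_j becomes 1 - (q z_j/z_i + (1-q) z_j), and that bound is the ratio of its geometric series
   on the torus. For i < j the series has only nonpositive powers of z_i and nonnegative powers of
   z_j. Thus in K the last variable has only nonnegative exponents and the first only nonpositive
   ones, which is why the initial condition is settled from these two ends. No contour is ever
   moved: all averages are taken over one torus, and exchanging variables or taking a residue is
   replaced by a statement on exponents of monomials that survives uniform limits. The convergence
   of the series defining the probability is also obtained from the contour side: its partial sums
   are averages of functions that converge uniformly on the torus. *)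
Declare Scope cx_scope.
Delimit Scope cx_scope with cx.
Bind Scope cx_scope with C.
Notation "a + b" := (Cadd a b) : cx_scope.
Notation "a - b" := (Csub a b) : cx_scope.
Notation "a * b" := (Cmul a b) : cx_scope.
Notation "a / b" := (Cdiv a b) : cx_scope.
Notation "- a" := (Copp a) : cx_scope.
Notation "/ a" := (Cinv a) : cx_scope.

Lemma C_eq (z w : C) : Re z = Re w -> Im z = Im w -> z = w.
Proof. destruct z, w; simpl; intros -> ->; reflexivity. Qed.

Lemma C_field : field_theory C0 C1 Cadd Cmul Csub Copp Cdiv Cinv (@eq C).
Proof.
  constructor.
  - constructor; intros; apply C_eq; simpl; ring.
  - intros H; apply (f_equal Re) in H; simpl in H; lra.
  - reflexivity.
  - intros [a b] H.
    assert (a ^ 2 + b ^ 2 <> 0) as Hd.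
    { intros E; apply H; apply C_eq; simpl; nra. }
    apply C_eq; cbn [Cmul Cinv C1 Re Im]; field; exact Hd.
Qed.

Add Field C_field_inst : C_field.

Lemma RtoC_add (a b : R) : RtoC (a + b) = (RtoC a + RtoC b)%cx.
Proof. apply C_eq; simpl; ring. Qed.

Lemma RtoC_sub (a b : R) : RtoC (a - b) = (RtoC a - RtoC b)%cx.
Proof. apply C_eq; simpl; ring. Qed.

Lemma RtoC_mul (a b : R) : RtoC (a * b) = (RtoC a * RtoC b)%cx.
Proof. apply C_eq; simpl; ring. Qed.

Definition Cmod (z : C) : R := Complex.Cmod (Re z, Im z).

Lemma Cmod_mul (z w : C) : Cmod (z * w)%cx = Cmod z * Cmod w.
Proof. exact (Complex.Cmod_mult (Re z, Im z) (Re w, Im w)). Qed.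

Lemma Cmod_add (z w : C) : Cmod (z + w)%cx <= Cmod z + Cmod w.
Proof. exact (Complex.Cmod_triangle (Re z, Im z) (Re w, Im w)). Qed.

Lemma Cmod_opp (z : C) : Cmod (- z)%cx = Cmod z.
Proof. exact (Complex.Cmod_opp (Re z, Im z)). Qed.

Lemma Cmod_sub (z w : C) : Cmod (z - w)%cx <= Cmod z + Cmod w.
Proof. unfold Csub; rewrite <- (Cmod_opp w); apply Cmod_add. Qed.

Lemma Cmod_ge0 (z : C) : 0 <= Cmod z.
Proof. apply Complex.Cmod_ge_0. Qed.

Lemma Cmod_RtoC (a : R) : Cmod (RtoC a) = Rabs a.
Proof. exact (Complex.Cmod_R a). Qed.

Lemma Cmod_C0 : Cmod C0 = 0.
Proof. exact Complex.Cmod_0. Qed.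

Lemma Cmod_C1 : Cmod C1 = 1.
Proof. exact Complex.Cmod_1. Qed.

Lemma Cmod_gt0_neq (z : C) : 0 < Cmod z -> z <> C0.
Proof. intros H E; rewrite E, Cmod_C0 in H; lra. Qed.

Lemma Cmod_inv (z : C) : z <> C0 -> Cmod (/ z)%cx = / Cmod z.
Proof.
  intros H.
  assert (Cmod (z * / z)%cx = 1) as E.
  { replace (z * / z)%cx with C1 by (field; exact H). apply Cmod_C1. }
  rewrite Cmod_mul in E.
  assert (Cmod z <> 0) by (intros F; rewrite F in E; lra).
  apply Rmult_eq_reg_l with (Cmod z); [rewrite E; field|]; assumption.
Qed.

Lemma Re_le_Cmod (z : C) : Rabs (Re z) <= Cmod z.
Proof. exact (Complex.re_le_Cmod (Re z, Im z)). Qed.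

Lemma Im_le_Cmod (z : C) : Rabs (Im z) <= Cmod z.
Proof.
  replace (Im z) with (Re (- (Ci * z))%cx) by (simpl; ring).
  eapply Rle_trans; [apply Re_le_Cmod|].
  rewrite Cmod_opp, Cmod_mul.
  replace (Cmod Ci) with 1 by (symmetry; exact Complex.Cmod_Ci). lra.
Qed.

Lemma Cmod_le_Re_Im (z : C) : Cmod z <= Rabs (Re z) + Rabs (Im z).
Proof.
  replace z with (RtoC (Re z) + RtoC (Im z) * Ci)%cx at 1
    by (apply C_eq; simpl; ring).
  eapply Rle_trans; [apply Cmod_add|].
  rewrite Cmod_mul, !Cmod_RtoC.
  replace (Cmod Ci) with 1 by (symmetry; exact Complex.Cmod_Ci). lra.
Qed.

(** * Iterated integrals and torus averages *)

(** A total companion of the relation [iter_int]: [RInt] has a value even before integrability is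
    known, so an inner integral can be named as a function of the outer angle. *)
Fixpoint iint (n : nat) (f : list R -> R) : R :=
  match n with
  | O => f nil
  | S m => RInt (fun th => iint m (fun l => f (th :: l))) 0 (2 * PI)
  end.

Lemma two_PI_pos : 0 < 2 * PI.
Proof. generalize PI_RGT_0; lra. Qed.

Lemma iter_int_S_intro (n : nat) (f : list R -> R) (g : R -> R) (v : R) :
  (forall th, iter_int n (fun l => f (th :: l)) (g th)) ->
  is_RInt g 0 (2 * PI) v -> iter_int (S n) f v.
Proof.
  intros Hg Hv.
  assert (ex_RInt g 0 (2 * PI)) as He by (exists v; exact Hv).
  apply (iter_intS n f g v Hg (ex_RInt_Reals_0 _ _ _ He)).
  rewrite <- RInt_Reals. now apply is_RInt_unique.
Qed.

Lemma iter_int_iint (n : nat) (f : list R -> R) (v : R) : iter_int n f v -> v = iint n f.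
Proof.
  intros H; induction H as [f|n f g v Hg IH pr Hv]; [reflexivity|].
  rewrite <- Hv, <- RInt_Reals; simpl.
  apply RInt_ext; intros th _; apply IH.
Qed.

Lemma iter_int_S_inv (n : nat) (f : list R -> R) (v : R) :
  iter_int (S n) f v ->
  (forall th, iter_int n (fun l => f (th :: l)) (iint n (fun l => f (th :: l)))) /\
  is_RInt (fun th => iint n (fun l => f (th :: l))) 0 (2 * PI) v.
Proof.
  intros H; inversion H as [|n' f' g v' Hg pr Hv]; subst; split.
  - intros th; rewrite <- (iter_int_iint _ _ _ (Hg th)); apply Hg.
  - apply is_RInt_ext with g; [intros th _; apply iter_int_iint, Hg|].
    rewrite <- RInt_Reals; apply (RInt_correct (V := R_CompleteNormedModule)).
    apply ex_RInt_Reals_1; exact pr.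
Qed.

Lemma iter_int_ext (n : nat) (f g : list R -> R) (v : R) :
  (forall l, length l = n -> f l = g l) -> iter_int n f v -> iter_int n g v.
Proof.
  intros E H; revert g E; induction H as [f|n f h v Hg IH pr Hv]; intros g E.
  - rewrite (E nil eq_refl); constructor.
  - apply (iter_intS n g h v) with pr; [|exact Hv].
    intros th; apply IH; intros l Hl; apply E; simpl; now f_equal.
Qed.

Lemma iter_int_lin (n : nat) (a b : R) (f g : list R -> R) (v w : R) :
  iter_int n f v -> iter_int n g w ->
  iter_int n (fun l => a * f l + b * g l) (a * v + b * w).
Proof.
  revert f g v w; induction n as [|n IH]; intros f g v w Hf Hg.
  - rewrite (iter_int_iint _ _ _ Hf), (iter_int_iint _ _ _ Hg).
    apply (iter_int0 (fun l => a * f l + b * g l)).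
  - destruct (iter_int_S_inv _ _ _ Hf) as [Hf1 Hf2].
    destruct (iter_int_S_inv _ _ _ Hg) as [Hg1 Hg2].
    apply iter_int_S_intro with (fun th => a * iint n (fun l => f (th :: l)) +
                                           b * iint n (fun l => g (th :: l))).
    + intros th; apply (IH (fun l => f (th :: l)) (fun l => g (th :: l))); auto.
    + apply (is_RInt_plus (V := R_NormedModule));
        apply (is_RInt_scal (V := R_NormedModule)); assumption.
Qed.

Lemma iter_int_const (n : nat) (c : R) : iter_int n (fun _ => c) (c * (2 * PI) ^ n).
Proof.
  induction n as [|n IH].
  - replace (c * (2 * PI) ^ 0) with c by (simpl; ring). apply (iter_int0 (fun _ => c)).
  - apply iter_int_S_intro with (fun _ => c * (2 * PI) ^ n); [intros; exact IH|].
    replace (c * (2 * PI) ^ S n) with (scal (2 * PI - 0) (c * (2 * PI) ^ n))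
      by (unfold scal; simpl; unfold mult; simpl; ring).
    apply (is_RInt_const (V := R_NormedModule)).
Qed.

Lemma iter_int_bound (n : nat) (f : list R -> R) (v M : R) :
  (forall l, length l = n -> Rabs (f l) <= M) -> iter_int n f v ->
  Rabs v <= (2 * PI) ^ n * M.
Proof.
  revert f v; induction n as [|n IH]; intros f v Hb Hf.
  - rewrite (iter_int_iint _ _ _ Hf); simpl; rewrite Rmult_1_l; now apply Hb.
  - destruct (iter_int_S_inv _ _ _ Hf) as [H1 H2].
    replace ((2 * PI) ^ S n * M) with ((2 * PI - 0) * ((2 * PI) ^ n * M)) by (simpl; ring).
    apply (norm_RInt_le_const (V := R_NormedModule) (fun th => iint n (fun l => f (th :: l))));
      [apply Rlt_le, two_PI_pos| |exact H2].
    intros th _. apply (IH (fun l => f (th :: l))); [|apply H1].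
    intros l Hl; apply Hb; simpl; now f_equal.
Qed.

(** Uniformity over all angles passes to the inner integrals, since integrating multiplies a uniform
    bound by a constant; the one-dimensional limit theorem then applies to the outer variable.
    Integrability of the limit at every level is part of the conclusion. *)
Lemma iter_int_lim (n : nat) (fk : nat -> list R -> R) (f : list R -> R) (vk : nat -> R) :
  (forall k, iter_int n (fk k) (vk k)) ->
  (forall e, 0 < e -> exists k0, forall k, (k0 <= k)%nat ->
     forall l, length l = n -> Rabs (fk k l - f l) <= e) ->
  exists v, iter_int n f v /\ Un_cv vk v.
Proof.
  revert fk f vk; induction n as [|n IH]; intros fk f vk Hk Hu.
  - exists (f nil); split; [constructor|].
    intros e He. destruct (Hu (e / 2)) as [k0 H0]; [lra|].
    exists k0; intros k Hkk. rewrite (iter_int_iint _ _ _ (Hk k)).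
    unfold Rdist; simpl. specialize (H0 k Hkk nil eq_refl). lra.
  - set (gk := fun k th => iint n (fun l => fk k (th :: l))).
    set (g := fun th => iint n (fun l => f (th :: l))).
    assert (forall th, iter_int n (fun l => f (th :: l)) (g th)) as Hg.
    { intros th.
      destruct (IH (fun k l => fk k (th :: l)) (fun l => f (th :: l)) (fun k => gk k th))
        as [v [Hv _]].
      - intros k; apply (iter_int_S_inv _ _ _ (Hk k)).
      - intros e He; destruct (Hu e He) as [k0 H0]; exists k0; intros k Hkk l Hl.
        apply H0; [assumption|simpl; now f_equal].
      - unfold g; rewrite <- (iter_int_iint _ _ _ Hv); exact Hv. }
    destruct (filterlim_RInt (V := R_CompleteNormedModule) gk 0 (2 * PI)
                Hierarchy.eventually Hierarchy.eventually_filter g vk) as [v [H1 H2]].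
    + intros k; apply (iter_int_S_inv _ _ _ (Hk k)).
    + intros P [eps HP].
      assert (0 < (2 * PI) ^ n) as Hpi by (apply pow_lt, two_PI_pos).
      (* The n inner integrations cost a factor (2π)^n; the half turns the weak inequality into a
         strict one. *)
      destruct (Hu (eps / 2 / (2 * PI) ^ n)) as [k0 H0].
      { apply Rdiv_lt_0_compat; [|assumption]. generalize (cond_pos eps); lra. }
      exists k0; intros k Hkk; apply HP; intros th.
      change (Rabs (gk k th - g th) < eps).
      assert (iter_int n (fun l => 1 * fk k (th :: l) + (-1) * f (th :: l))
                (1 * gk k th + (-1) * g th)) as Hd.
      { apply (iter_int_lin n 1 (-1) (fun l => fk k (th :: l)) (fun l => f (th :: l))).
        - apply (iter_int_S_inv _ _ _ (Hk k)).
        - apply Hg. }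
      replace (gk k th - g th) with (1 * gk k th + -1 * g th) by ring.
      eapply Rle_lt_trans.
      * eapply iter_int_bound; [|exact Hd].
        intros l Hl; simpl.
        replace (1 * fk k (th :: l) + -1 * f (th :: l)) with
          (fk k (th :: l) - f (th :: l)) by ring.
        apply H0; [assumption|simpl; now f_equal].
      * replace ((2 * PI) ^ n * (eps / 2 / (2 * PI) ^ n)) with (eps / 2) by (field; lra).
        generalize (cond_pos eps); lra.
    + exists v; split; [apply iter_int_S_intro with g; assumption|].
      apply is_lim_seq_Reals; exact H1.
Qed.

Definition torus (n : nat) (r : R) (zs : list C) : Prop :=
  length zs = n /\ Forall (fun z => Cmod z = r) zs.

Lemma torus_cons (n : nat) (r : R) (z : C) (zs : list C) :
  torus (S n) r (z :: zs) <-> Cmod z = r /\ torus n r zs.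
Proof.
  unfold torus; simpl; split.
  - intros [H1 H2]; inversion H2; subst; auto.
  - intros [H1 [H2 H3]]; split; [now f_equal|now constructor].
Qed.

Lemma torus_nth (n : nat) (r : R) (zs : list C) (j : nat) (d : C) :
  torus n r zs -> (j < n)%nat -> Cmod (nth j zs d) = r.
Proof.
  intros [H1 H2] Hj; rewrite Forall_forall in H2; apply H2, nth_In; lia.
Qed.

Lemma Cmod_circ (r th : R) : 0 <= r -> Cmod (circ r th) = r.
Proof.
  intros Hr; unfold Cmod, circ, Complex.Cmod; simpl.
  replace (r * cos th * (r * cos th * 1) + r * sin th * (r * sin th * 1)) with (r * r).
  - now apply sqrt_square.
  - generalize (sin2_cos2 th); unfold Rsqr; intros E.
    transitivity (r * r * (sin th * sin th + cos th * cos th)); [rewrite E|]; ring.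
Qed.

Lemma torus_circ (n : nat) (r : R) (ths : list R) :
  0 <= r -> length ths = n -> torus n r (map (circ r) ths).
Proof.
  intros Hr Hl; split; [now rewrite length_map|].
  apply Forall_forall; intros z Hz; apply in_map_iff in Hz as [th [<- _]].
  now apply Cmod_circ.
Qed.

Definition unif_lim (n : nat) (r : R) (Fk : nat -> list C -> C) (F : list C -> C) : Prop :=
  forall e, 0 < e -> exists k0, forall k, (k0 <= k)%nat ->
    forall zs, torus n r zs -> Cmod (Fk k zs - F zs)%cx <= e.

Lemma unif_lim_const (n : nat) (r : R) (F G : list C -> C) :
  (forall zs, torus n r zs -> F zs = G zs) -> unif_lim n r (fun _ => F) G.
Proof.
  intros E e He; exists 0%nat; intros k _ zs Hz; rewrite (E zs Hz).
  replace (G zs - G zs)%cx with C0 by ring. rewrite Cmod_C0; lra.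
Qed.

(* The factor [(2 * PI) ^ n] makes [v] the average of [F] over the torus. *)
Definition has_mean (n : nat) (r : R) (F : list C -> C) (v : C) : Prop :=
  iter_int n (fun ths => Re (F (map (circ r) ths))) (Re v * (2 * PI) ^ n) /\
  iter_int n (fun ths => Im (F (map (circ r) ths))) (Im v * (2 * PI) ^ n).

Lemma two_PI_pow_pos (n : nat) : 0 < (2 * PI) ^ n.
Proof. apply pow_lt, two_PI_pos. Qed.

Lemma has_mean_ext (n : nat) (r : R) (F G : list C -> C) (v : C) :
  0 <= r -> (forall zs, torus n r zs -> F zs = G zs) ->
  has_mean n r F v -> has_mean n r G v.
Proof.
  intros Hr E [H1 H2]; split;
    [eapply iter_int_ext; [|exact H1]|eapply iter_int_ext; [|exact H2]];
    intros l Hl; simpl; now rewrite (E _ (torus_circ n r l Hr Hl)).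
Qed.

Lemma has_mean_unique (n : nat) (r : R) (F : list C -> C) (v w : C) :
  has_mean n r F v -> has_mean n r F w -> v = w.
Proof.
  intros [H1 H2] [H3 H4].
  generalize (two_PI_pow_pos n); intros Hp.
  apply C_eq; apply Rmult_eq_reg_r with ((2 * PI) ^ n); try lra.
  - now rewrite (iter_int_iint _ _ _ H1), (iter_int_iint _ _ _ H3).
  - now rewrite (iter_int_iint _ _ _ H2), (iter_int_iint _ _ _ H4).
Qed.

Lemma iter_int_eq (n : nat) (f g : list R -> R) (v w : R) :
  iter_int n f v -> (forall l, f l = g l) -> v = w -> iter_int n g w.
Proof. intros H E <-; eapply iter_int_ext; [|exact H]; auto. Qed.

Lemma has_mean_lin (n : nat) (r : R) (a : C) (F G : list C -> C) (v w : C) :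
  has_mean n r F v -> has_mean n r G w ->
  has_mean n r (fun zs => a * F zs + G zs)%cx (a * v + w)%cx.
Proof.
  intros [H1 H2] [H3 H4]; split.
  - eapply iter_int_eq;
      [exact (iter_int_lin n 1 1 _ _ _ _ (iter_int_lin n (Re a) (- Im a) _ _ _ _ H1 H2) H3)
      |intros l|]; simpl; ring.
  - eapply iter_int_eq;
      [exact (iter_int_lin n 1 1 _ _ _ _ (iter_int_lin n (Re a) (Im a) _ _ _ _ H2 H1) H4)
      |intros l|]; simpl; ring.
Qed.

Lemma has_mean_const (n : nat) (r : R) (c : C) : has_mean n r (fun _ => c) c.
Proof. split; apply iter_int_const. Qed.

(** The factor 2 comes from bounding the real and imaginary parts separately. *)
Lemma has_mean_bound (n : nat) (r : R) (F : list C -> C) (v : C) (M : R) :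
  0 <= r -> (forall zs, torus n r zs -> Cmod (F zs) <= M) ->
  has_mean n r F v -> Cmod v <= 2 * M.
Proof.
  intros Hr Hb [H1 H2].
  generalize (two_PI_pow_pos n); intros Hp.
  apply iter_int_bound with (M := M) in H1.
  2:{ intros l Hl; eapply Rle_trans; [apply Re_le_Cmod|apply Hb, torus_circ; auto]. }
  apply iter_int_bound with (M := M) in H2.
  2:{ intros l Hl; eapply Rle_trans; [apply Im_le_Cmod|apply Hb, torus_circ; auto]. }
  rewrite Rabs_mult, (Rabs_pos_eq _ (Rlt_le _ _ Hp)) in H1, H2.
  eapply Rle_trans; [apply Cmod_le_Re_Im|].
  assert (Rabs (Re v) <= M) by (apply Rmult_le_reg_r with ((2 * PI) ^ n); lra).
  assert (Rabs (Im v) <= M) by (apply Rmult_le_reg_r with ((2 * PI) ^ n); lra).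
  lra.
Qed.

Lemma has_mean_dist (n : nat) (r : R) (F G : list C -> C) (v w : C) (M : R) :
  0 <= r -> (forall zs, torus n r zs -> Cmod (F zs - G zs)%cx <= M) ->
  has_mean n r F v -> has_mean n r G w -> Cmod (v - w)%cx <= 2 * M.
Proof.
  intros Hr Hb Hv Hw.
  apply has_mean_bound with (n := n) (r := r) (F := fun zs => (RtoC (-1) * G zs + F zs)%cx); auto.
  - intros zs Hz. replace (RtoC (-1) * G zs + F zs)%cx with (F zs - G zs)%cx; [auto|].
    apply C_eq; simpl; ring.
  - replace (v - w)%cx with (RtoC (-1) * w + v)%cx by (apply C_eq; simpl; ring).
    now apply has_mean_lin.
Qed.

Lemma has_mean_lim (n : nat) (r : R) (Fk : nat -> list C -> C) (F : list C -> C) (vk : nat -> C) :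
  0 <= r -> (forall k, has_mean n r (Fk k) (vk k)) -> unif_lim n r Fk F ->
  exists v, has_mean n r F v.
Proof.
  intros Hr Hk Hu.
  destruct (iter_int_lim n (fun k l => Re (Fk k (map (circ r) l)))
              (fun l => Re (F (map (circ r) l))) (fun k => Re (vk k) * (2 * PI) ^ n))
    as [a [Ha _]].
  { intros k; apply Hk. }
  { intros e He; destruct (Hu e He) as [k0 H0]; exists k0; intros k Hkk l Hl.
    eapply Rle_trans; [|apply (H0 k Hkk _ (torus_circ n r l Hr Hl))].
    eapply Rle_trans; [|apply Re_le_Cmod]; apply Req_le; reflexivity. }
  destruct (iter_int_lim n (fun k l => Im (Fk k (map (circ r) l)))
              (fun l => Im (F (map (circ r) l))) (fun k => Im (vk k) * (2 * PI) ^ n))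
    as [b [Hb _]].
  { intros k; apply Hk. }
  { intros e He; destruct (Hu e He) as [k0 H0]; exists k0; intros k Hkk l Hl.
    eapply Rle_trans; [|apply (H0 k Hkk _ (torus_circ n r l Hr Hl))].
    eapply Rle_trans; [|apply Im_le_Cmod]; apply Req_le; reflexivity. }
  generalize (two_PI_pow_pos n); intros Hp.
  exists (mkC (a / (2 * PI) ^ n) (b / (2 * PI) ^ n)); split; simpl.
  - replace (a / (2 * PI) ^ n * (2 * PI) ^ n) with a by (field; lra); exact Ha.
  - replace (b / (2 * PI) ^ n * (2 * PI) ^ n) with b by (field; lra); exact Hb.
Qed.

(** Carries an equality of averages, known for the approximants because they share [vk], over to the
    limits. *)
Lemma has_mean_lim_eq (n : nat) (r : R) (Fk Gk : nat -> list C -> C) (F G : list C -> C)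
    (vk : nat -> C) (v w : C) :
  0 <= r -> (forall k, has_mean n r (Fk k) (vk k)) -> (forall k, has_mean n r (Gk k) (vk k)) ->
  unif_lim n r Fk F -> unif_lim n r Gk G ->
  has_mean n r F v -> has_mean n r G w -> v = w.
Proof.
  intros Hr HF HG UF UG Hv Hw.
  assert (forall e, 0 < e -> Cmod (v - w)%cx <= e) as He.
  { intros e He.
    destruct (UF (e / 4)) as [k1 H1]; [lra|]. destruct (UG (e / 4)) as [k2 H2]; [lra|].
    set (k := max k1 k2).
    assert (Cmod (vk k - v)%cx <= 2 * (e / 4)).
    { apply (has_mean_dist n r (Fk k) F); auto; intros; apply H1; auto; lia. }
    assert (Cmod (vk k - w)%cx <= 2 * (e / 4)).
    { apply (has_mean_dist n r (Gk k) G); auto; intros; apply H2; auto; lia. }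
    replace (v - w)%cx with ((vk k - w) - (vk k - v))%cx by ring.
    eapply Rle_trans; [apply Cmod_sub|]; lra. }
  assert (forall x, (forall e, 0 < e -> Rabs x <= e) -> x = 0) as H0.
  { intros x Hx; destruct (Req_dec x 0) as [|Hn]; [assumption|].
    specialize (Hx (Rabs x / 2)). generalize (Rabs_pos_lt x Hn); lra. }
  assert (v - w = C0)%cx as E.
  { apply C_eq; apply H0; intros e Hp; eapply Rle_trans.
    - apply Re_le_Cmod.
    - auto.
    - apply Im_le_Cmod.
    - auto. }
  replace v with ((v - w) + w)%cx by ring. rewrite E; ring.
Qed.

(** The separated case of Fubini, enough to average monomials. The real and imaginary parts of the
    product each mix two real integrals. *)
Lemma has_mean_sep (n : nat) (r : R) (h : C -> C) (c : C) (F : list C -> C) (v : C) :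
  is_RInt (fun th => Re (h (circ r th))) 0 (2 * PI) (Re c * (2 * PI)) ->
  is_RInt (fun th => Im (h (circ r th))) 0 (2 * PI) (Im c * (2 * PI)) ->
  has_mean n r F v ->
  has_mean (S n) r (fun l => h (hd C0 l) * F (tl l))%cx (c * v)%cx.
Proof.
  intros H1 H2 [H3 H4]; split.
  - apply iter_int_S_intro with
      (fun th => Re (h (circ r th)) * (Re v * (2 * PI) ^ n) +
                 (- Im (h (circ r th))) * (Im v * (2 * PI) ^ n)).
    + intros th; eapply iter_int_eq;
        [exact (iter_int_lin n (Re (h (circ r th))) (- Im (h (circ r th))) _ _ _ _ H3 H4)
        |intros l|]; simpl; ring.
    + replace (Re (c * v)%cx * (2 * PI) ^ S n) with
        (plus (scal (Re v * (2 * PI) ^ n) (Re c * (2 * PI)))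
           (scal (- (Im v * (2 * PI) ^ n)) (Im c * (2 * PI))))
        by (unfold plus, scal; simpl; unfold mult; simpl; ring).
      eapply is_RInt_ext.
      2: apply (is_RInt_plus (V := R_NormedModule));
        apply (is_RInt_scal (V := R_NormedModule)); eassumption.
      intros th _; unfold plus, scal; simpl; unfold mult; simpl; ring.
  - apply iter_int_S_intro with
      (fun th => Re (h (circ r th)) * (Im v * (2 * PI) ^ n) +
                 Im (h (circ r th)) * (Re v * (2 * PI) ^ n)).
    + intros th; eapply iter_int_eq;
        [exact (iter_int_lin n (Re (h (circ r th))) (Im (h (circ r th))) _ _ _ _ H4 H3)
        |intros l|]; simpl; ring.
    + replace (Im (c * v)%cx * (2 * PI) ^ S n) with
        (plus (scal (Im v * (2 * PI) ^ n) (Re c * (2 * PI)))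
           (scal (Re v * (2 * PI) ^ n) (Im c * (2 * PI))))
        by (unfold plus, scal; simpl; unfold mult; simpl; ring).
      eapply is_RInt_ext.
      2: apply (is_RInt_plus (V := R_NormedModule));
        apply (is_RInt_scal (V := R_NormedModule)); eassumption.
      intros th _; unfold plus, scal; simpl; unfold mult; simpl; ring.
Qed.

Lemma has_mean_tl (n : nat) (r : R) (F : list C -> C) (v : C) :
  has_mean n r F v -> has_mean (S n) r (fun l => F (tl l)) v.
Proof.
  intros [H1 H2]; split; simpl.
  - apply iter_int_S_intro with (fun _ => Re v * (2 * PI) ^ n); [intros; exact H1|].
    replace (Re v * (2 * PI * (2 * PI) ^ n)) with (scal (2 * PI - 0) (Re v * (2 * PI) ^ n))
      by (unfold scal; simpl; unfold mult; simpl; ring).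
    apply (is_RInt_const (V := R_NormedModule)).
  - apply iter_int_S_intro with (fun _ => Im v * (2 * PI) ^ n); [intros; exact H2|].
    replace (Im v * (2 * PI * (2 * PI) ^ n)) with (scal (2 * PI - 0) (Im v * (2 * PI) ^ n))
      by (unfold scal; simpl; unfold mult; simpl; ring).
    apply (is_RInt_const (V := R_NormedModule)).
Qed.

(** * Integer powers and their averages over a circle *)

Lemma Cpown_neq0 (z : C) (n : nat) : z <> C0 -> Cpown z n <> C0.
Proof.
  intros Hz; induction n as [|n IH]; simpl.
  - apply (F_1_neq_0 C_field).
  - intros E; apply IH. replace (Cpown z n) with (/ z * (z * Cpown z n))%cx by (field; exact Hz).
    rewrite E; ring.
Qed.

Lemma Cinv_C1 : (/ C1)%cx = C1.
Proof. field. apply (F_1_neq_0 C_field). Qed.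

Lemma Cpowz_of_nat (z : C) (n : nat) : Cpowz z (Z.of_nat n) = Cpown z n.
Proof.
  unfold Cpowz; destruct (Z.leb_spec 0 (Z.of_nat n)); [now rewrite Nat2Z.id|lia].
Qed.

Lemma Cpowz_opp_of_nat (z : C) (n : nat) : Cpowz z (- Z.of_nat n) = (/ Cpown z n)%cx.
Proof.
  destruct n as [|n]; [simpl; symmetry; apply Cinv_C1|].
  unfold Cpowz; destruct (Z.leb_spec 0 (- Z.of_nat (S n))); [lia|].
  now rewrite Z.opp_involutive, Nat2Z.id.
Qed.

Lemma Cpowz_succ (z : C) (k : Z) : z <> C0 -> Cpowz z (k + 1) = (z * Cpowz z k)%cx.
Proof.
  intros Hz; destruct (Z_le_gt_dec 0 k) as [Hk|Hk].
  - rewrite <- (Z2Nat.id k) by exact Hk.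
    replace (Z.of_nat (Z.to_nat k) + 1)%Z with (Z.of_nat (S (Z.to_nat k))) by lia.
    rewrite !Cpowz_of_nat; reflexivity.
  - replace k with (- Z.of_nat (S (Z.to_nat (- k - 1))))%Z by lia.
    set (m := Z.to_nat (- k - 1)).
    replace (- Z.of_nat (S m) + 1)%Z with (- Z.of_nat m)%Z by lia.
    rewrite !Cpowz_opp_of_nat; simpl. field; split; [now apply Cpown_neq0|exact Hz].
Qed.

Lemma Cpowz_add (z : C) (a b : Z) : z <> C0 -> Cpowz z (a + b) = (Cpowz z a * Cpowz z b)%cx.
Proof.
  intros Hz; revert a b; apply (Z.bi_induction (fun a => forall b, _)).
  - intros x y ->; reflexivity.
  - intros b; change (Cpowz z 0) with C1; rewrite Z.add_0_l; ring.
  - intros a; unfold Z.succ; split; intros E b; specialize (E b);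
      replace (a + 1 + b)%Z with (a + b + 1)%Z in * by lia;
      rewrite !Cpowz_succ in * by exact Hz; [rewrite E; ring|].
    replace (Cpowz z (a + b)) with (/ z * (z * Cpowz z (a + b)))%cx by (field; exact Hz).
    rewrite E; field; exact Hz.
Qed.

Lemma Cpowz_1 (z : C) : Cpowz z 1 = z.
Proof. change (z * C1 = z)%cx; ring. Qed.

Lemma Cpowz_m1 (z : C) : Cpowz z (-1) = (/ z)%cx.
Proof. change (/ (z * C1) = / z)%cx; now replace (z * C1)%cx with z by ring. Qed.

Lemma Cpown_circ (r th : R) (n : nat) :
  Cpown (circ r th) n = mkC (r ^ n * cos (INR n * th)) (r ^ n * sin (INR n * th)).
Proof.
  induction n as [|n IH].
  - apply C_eq; simpl; rewrite Rmult_0_l, ?cos_0, ?sin_0; ring.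
  - replace (INR (S n) * th) with (th + INR n * th) by (rewrite S_INR; ring).
    change (Cpown (circ r th) (S n)) with (circ r th * Cpown (circ r th) n)%cx.
    rewrite IH, cos_plus, sin_plus; apply C_eq; simpl; ring.
Qed.

Lemma Cpowz_circ (r : R) (k : Z) : 0 < r -> exists rho, forall th,
  Cpowz (circ r th) k = mkC (rho * cos (IZR k * th)) (rho * sin (IZR k * th)).
Proof.
  intros Hr; destruct (Z_le_gt_dec 0 k) as [Hk|Hk].
  - exists (r ^ Z.to_nat k); intros th.
    rewrite <- (Z2Nat.id k) at 1 3 5 by exact Hk.
    rewrite Cpowz_of_nat, Cpown_circ, INR_IZR_INZ, !Z2Nat.id by exact Hk; reflexivity.
  - set (m := Z.to_nat (- k)). exists (/ r ^ m); intros th.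
    replace k with (- Z.of_nat m)%Z by lia.
    rewrite Cpowz_opp_of_nat, Cpown_circ, opp_IZR, <- INR_IZR_INZ.
    rewrite Ropp_mult_distr_l_reverse, cos_neg, sin_neg.
    set (x := INR m * th).
    assert (0 < r ^ m) as Hp by (apply pow_lt; exact Hr).
    assert ((r ^ m * cos x) ^ 2 + (r ^ m * sin x) ^ 2 = (r ^ m) ^ 2) as E.
    { generalize (sin2_cos2 x); unfold Rsqr; intros E0.
      transitivity ((r ^ m) ^ 2 * (sin x * sin x + cos x * cos x)); [ring|rewrite E0; ring]. }
    unfold Cinv; apply C_eq; cbn [Re Im]; rewrite E; field; lra.
Qed.

Lemma is_RInt_cos_Z (rho : R) (k : Z) :
  is_RInt (fun th => rho * cos (IZR k * th)) 0 (2 * PI)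
    (if Z.eqb k 0 then rho * (2 * PI) else 0).
Proof.
  destruct (Z.eqb_spec k 0) as [->|Hk].
  - replace (rho * (2 * PI)) with (scal (2 * PI - 0) rho)
      by (unfold scal; simpl; unfold mult; simpl; ring).
    apply is_RInt_ext with (fun _ => rho); [|apply (is_RInt_const (V := R_NormedModule))].
    intros x _; rewrite Rmult_0_l, cos_0; exact (eq_sym (Rmult_1_r rho)).
  - assert (IZR k <> 0) as Hk' by now apply not_0_IZR.
    replace 0 with (minus (rho * sin (IZR k * (2 * PI)) / IZR k)
                      (rho * sin (IZR k * 0) / IZR k)) at 2.
    + apply (is_RInt_derive (fun th => rho * sin (IZR k * th) / IZR k)).
      * intros x _; auto_derive; [auto|field; exact Hk'].
      * intros x _; apply continuity_pt_filterlim, derivable_continuous_pt; reg.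
    + rewrite Rmult_0_r, sin_0.
      replace (IZR k * (2 * PI)) with (IZR (2 * k) * PI) by (rewrite mult_IZR; ring).
      rewrite (sin_eq_0_1 (IZR (2 * k) * PI)) by (eexists; reflexivity).
      unfold minus, plus, opp; simpl; field; exact Hk'.
Qed.

Lemma is_RInt_sin_Z (rho : R) (k : Z) :
  is_RInt (fun th => rho * sin (IZR k * th)) 0 (2 * PI) 0.
Proof.
  destruct (Z.eqb_spec k 0) as [->|Hk].
  - apply is_RInt_ext with (fun _ => 0).
    + intros x _; rewrite Rmult_0_l, sin_0; exact (eq_sym (Rmult_0_r rho)).
    + generalize (is_RInt_const (V := R_NormedModule) 0 (2 * PI) 0).
      change (scal (2 * PI - 0) 0) with ((2 * PI - 0) * 0); rewrite Rmult_0_r; auto.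
  - assert (IZR k <> 0) as Hk' by now apply not_0_IZR.
    replace 0 with (minus (- rho * cos (IZR k * (2 * PI)) / IZR k)
                      (- rho * cos (IZR k * 0) / IZR k)) at 2.
    + apply (is_RInt_derive (fun th => - rho * cos (IZR k * th) / IZR k)).
      * intros x _; auto_derive; [auto|field; exact Hk'].
      * intros x _; apply continuity_pt_filterlim, derivable_continuous_pt; reg.
    (* The cosine at the upper end is 1, by cos(2a) = 1 - 2 sin(a)^2 with a = kπ. *)
    + replace (IZR k * (2 * PI)) with (2 * (IZR k * PI)) by ring.
      rewrite Rmult_0_r, cos_0, cos_2a_sin.
      rewrite (sin_eq_0_1 (IZR k * PI)) by (eexists; reflexivity).
      unfold minus, plus, opp; simpl; field; exact Hk'.
Qed.

Lemma is_RInt_Cpowz_circ (r : R) (k : Z) (c : C) : 0 < r ->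
  c = (if Z.eqb k 0 then C1 else C0) ->
  is_RInt (fun th => Re (Cpowz (circ r th) k)) 0 (2 * PI) (Re c * (2 * PI)) /\
  is_RInt (fun th => Im (Cpowz (circ r th) k)) 0 (2 * PI) (Im c * (2 * PI)).
Proof.
  intros Hr ->. destruct (Cpowz_circ r k Hr) as [rho Hrho].
  split.
  - apply is_RInt_ext with (fun th => rho * cos (IZR k * th));
      [intros x _; now rewrite Hrho|].
    replace (Re (if Z.eqb k 0 then C1 else C0) * (2 * PI)) with
      (if Z.eqb k 0 then rho * (2 * PI) else 0); [apply is_RInt_cos_Z|].
    destruct (Z.eqb_spec k 0) as [->|Hk]; simpl; [|ring].
    (* For exponent 0 the power is 1, so evaluating at angle 0 gives [rho] = 1. *)
    specialize (Hrho 0); apply (f_equal Re) in Hrho; simpl in Hrho.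
    rewrite Rmult_0_l, cos_0 in Hrho; rewrite Hrho; ring.
  - apply is_RInt_ext with (fun th => rho * sin (IZR k * th));
      [intros x _; now rewrite Hrho|].
    replace (Im (if Z.eqb k 0 then C1 else C0) * (2 * PI)) with 0;
      [apply is_RInt_sin_Z|destruct (Z.eqb k 0); simpl; ring].
Qed.

(** * Uniform limits of Laurent polynomials *)

Fixpoint mono (k : nat -> Z) (zs : list C) : C :=
  match zs with
  | nil => C1
  | z :: t => (Cpowz z (k O) * mono (fun i => k (S i)) t)%cx
  end.

Definition exp_add (k l : nat -> Z) : nat -> Z := fun i => (k i + l i)%Z.
Definition unit_exp (j : nat) (c : Z) : nat -> Z := fun i => if Nat.eqb i j then c else 0%Z.
Definition exp_cons (a : Z) (k : nat -> Z) : nat -> Z :=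
  fun i => match i with O => a | S i => k i end.

Lemma torus_neq0 (n : nat) (r : R) (zs : list C) :
  0 < r -> torus n r zs -> Forall (fun z => z <> C0) zs.
Proof.
  intros Hr [_ H]; eapply Forall_impl; [|exact H].
  intros z Hz; apply Cmod_gt0_neq; simpl in Hz; lra.
Qed.

Lemma mono_exp_add (k l : nat -> Z) (zs : list C) :
  Forall (fun z => z <> C0) zs -> mono (exp_add k l) zs = (mono k zs * mono l zs)%cx.
Proof.
  intros H; revert k l; induction H as [|z zs Hz H IH]; intros k l; simpl; [ring|].
  unfold exp_add at 1; rewrite Cpowz_add by exact Hz.
  change (fun i => exp_add k l (S i)) with (exp_add (fun i => k (S i)) (fun i => l (S i))).
  rewrite IH; ring.
Qed.

Lemma mono_0 (zs : list C) : mono (fun _ => 0%Z) zs = C1.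
Proof.
  induction zs as [|z zs IH]; simpl; [reflexivity|].
  rewrite IH; change (Cpowz z 0) with C1; ring.
Qed.

Lemma mono_unit_exp (j : nat) (c : Z) (zs : list C) :
  (j < length zs)%nat -> mono (unit_exp j c) zs = Cpowz (nth j zs C0) c.
Proof.
  revert zs; induction j as [|j IH]; intros [|z zs] Hj; simpl in *; try lia.
  - change (fun i => unit_exp 0 c (S i)) with (fun _ : nat => 0%Z).
    rewrite mono_0; change (unit_exp 0 c 0) with c; ring.
  - change (fun i => unit_exp (S j) c (S i)) with (unit_exp j c).
    rewrite IH by lia; change (unit_exp (S j) c 0) with 0%Z.
    change (Cpowz z 0) with C1; ring.
Qed.

(** A bound on the Fourier support without writing a series: [P] restricts the exponents of the
    monomials used. Bounds, products and averages all follow by induction on membership. Constant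
    sequences in [laurent_lim] make the class insensitive to values off the torus. *)
Inductive laurent (n : nat) (r : R) (P : (nat -> Z) -> Prop) : (list C -> C) -> Prop :=
| laurent_mono k : P k -> laurent n r P (mono k)
| laurent_lin a F G : laurent n r P F -> laurent n r P G ->
    laurent n r P (fun zs => a * F zs + G zs)%cx
| laurent_lim Fk F : (forall i : nat, laurent n r P (Fk i)) -> unif_lim n r Fk F ->
    laurent n r P F.

(** One predicate for three uses: s = 1 bounds the exponent of variable m from below by c, s = -1
    bounds it from above by -c, and s = 0 with c = 0 imposes nothing. *)
Definition level (s : Z) (m : nat) (c : Z) (k : nat -> Z) : Prop := (c <= s * k m)%Z.

Section Laurent.
Variables (n : nat) (r : R).
Hypothesis Hr : 0 < r.

Lemma laurent_ext (P : (nat -> Z) -> Prop) (F G : list C -> C) :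
  (forall zs, torus n r zs -> F zs = G zs) -> laurent n r P F -> laurent n r P G.
Proof.
  intros E H; apply laurent_lim with (fun _ => F); [auto|now apply unif_lim_const].
Qed.

Lemma laurent_scal (P : (nat -> Z) -> Prop) (a : C) (F : list C -> C) :
  laurent n r P F -> laurent n r P (fun zs => a * F zs)%cx.
Proof.
  (* The class has no zero function at hand when [P] is arbitrary, so the second summand of
     [laurent_lin] is [F] itself. *)
  intros H; apply laurent_ext with (fun zs => (a - C1) * F zs + F zs)%cx.
  - intros zs _; ring.
  - now apply laurent_lin.
Qed.

Lemma laurent_add (P : (nat -> Z) -> Prop) (F G : list C -> C) :
  laurent n r P F -> laurent n r P G -> laurent n r P (fun zs => F zs + G zs)%cx.
Proof.
  intros HF HG; apply laurent_ext with (fun zs => C1 * F zs + G zs)%cx.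
  - intros zs _; ring.
  - now apply laurent_lin.
Qed.

Lemma laurent_sub (P : (nat -> Z) -> Prop) (F G : list C -> C) :
  laurent n r P F -> laurent n r P G -> laurent n r P (fun zs => F zs - G zs)%cx.
Proof.
  intros HF HG; apply laurent_ext with (fun zs => (- C1) * G zs + F zs)%cx.
  - intros zs _; ring.
  - now apply laurent_lin.
Qed.

Lemma laurent_const (s : Z) (m : nat) (c : C) : laurent n r (level s m 0) (fun _ => c).
Proof.
  apply laurent_ext with (fun zs => c * mono (fun _ => 0%Z) zs)%cx.
  - intros zs _; rewrite mono_0; ring.
  - apply laurent_scal, laurent_mono; unfold level; lia.
Qed.

(** Boundedness is what keeps a uniform limit uniform after multiplication by a fixed factor. For a
    limit, one approximant at distance at most 1 gives the bound. *)
Lemma laurent_bounded (P : (nat -> Z) -> Prop) (F : list C -> C) :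
  laurent n r P F -> exists M, 0 <= M /\ forall zs, torus n r zs -> Cmod (F zs) <= M.
Proof.
  induction 1 as [k Hk|a F G _ [M [M0 HM]] _ [M' [M0' HM']]|Fk F _ IH Hu].
  - assert (forall n, exists M, 0 <= M /\ forall zs, torus n r zs -> Cmod (mono k zs) <= M) as H.
    { clear Hk. intros n'; revert k; induction n' as [|n' IH]; intros k.
      - exists 1; split; [lra|]. intros [|z zs] [Hl _]; simpl in *; [|lia].
        rewrite Cmod_C1; lra.
      - destruct (IH (fun i => k (S i))) as [M [M0 HM]].
        assert (exists p, 0 <= p /\ forall z, Cmod z = r -> Cmod (Cpowz z (k 0%nat)) <= p)
          as [p [p0 Hp]].
        { assert (forall z j, Cmod (Cpown z j) = Cmod z ^ j) as E.
          { intros z j; induction j as [|j IHj]; simpl; [apply Cmod_C1|].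
            now rewrite Cmod_mul, IHj. }
          set (j := Z.to_nat (k 0%nat)); set (j' := Z.to_nat (- k 0%nat)).
          exists (r ^ j + / r ^ j').
          assert (0 < r ^ j) by now apply pow_lt.
          assert (0 < / r ^ j') by now apply Rinv_0_lt_compat, pow_lt.
          split; [lra|].
          intros z Hz; unfold Cpowz; fold j j'; destruct (Z.leb 0 (k 0%nat)).
          - rewrite E, Hz; lra.
          - rewrite Cmod_inv, E, Hz; [lra|]. apply Cpown_neq0, Cmod_gt0_neq; lra. }
        exists (p * M); split; [now apply Rmult_le_pos|].
        intros [|z zs] Hz; [destruct Hz; simpl in *; lia|].
        apply torus_cons in Hz as [Hz Hzs]; simpl; rewrite Cmod_mul.
        apply Rmult_le_compat; auto using Cmod_ge0. }
    apply H.
  - exists (Cmod a * M + M'); split.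
    + generalize (Rmult_le_pos _ _ (Cmod_ge0 a) M0); lra.
    + intros zs Hz; eapply Rle_trans; [apply Cmod_add|]; rewrite Cmod_mul.
      generalize (Rmult_le_compat_l _ _ _ (Cmod_ge0 a) (HM zs Hz)) (HM' zs Hz); lra.
  - destruct (Hu 1) as [k0 H0]; [lra|].
    destruct (IH k0) as [M [M0 HM]]. exists (M + 1); split; [lra|].
    intros zs Hz; replace (F zs) with (Fk k0 zs - (Fk k0 zs - F zs))%cx by ring.
    eapply Rle_trans; [apply Cmod_sub|].
    specialize (H0 k0 (le_n _) zs Hz); specialize (HM zs Hz); lra.
Qed.

Lemma unif_lim_mul_l (F : list C -> C) (Gk : nat -> list C -> C) (G : list C -> C) (M : R) :
  0 <= M -> (forall zs, torus n r zs -> Cmod (F zs) <= M) -> unif_lim n r Gk G ->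
  unif_lim n r (fun i zs => F zs * Gk i zs)%cx (fun zs => F zs * G zs)%cx.
Proof.
  intros M0 HM Hu e He.
  destruct (Hu (e / (M + 1))) as [k0 H0]; [apply Rdiv_lt_0_compat; lra|].
  exists k0; intros k Hk zs Hz.
  replace (F zs * Gk k zs - F zs * G zs)%cx with (F zs * (Gk k zs - G zs))%cx by ring.
  rewrite Cmod_mul. specialize (H0 k Hk zs Hz); specialize (HM zs Hz).
  eapply Rle_trans; [apply Rmult_le_compat; eauto using Cmod_ge0|].
  apply Rle_trans with ((M + 1) * (e / (M + 1))).
  - apply Rmult_le_compat_r; [|lra]. apply Rlt_le, Rdiv_lt_0_compat; lra.
  - apply Req_le; field; lra.
Qed.

(** Exponents add on monomials. The induction on [F] reduces to a monomial, and a nested induction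
    on [G] finishes; in each limit case the other factor is bounded. *)
Lemma laurent_mul (P1 P2 P3 : (nat -> Z) -> Prop) (F G : list C -> C) :
  (forall k l, P1 k -> P2 l -> P3 (exp_add k l)) ->
  laurent n r P1 F -> laurent n r P2 G -> laurent n r P3 (fun zs => F zs * G zs)%cx.
Proof.
  intros HP HF HG; induction HF as [k Hk|a F F' _ IH _ IH'|Fk F _ IH Hu].
  - destruct (laurent_bounded (fun _ => True) (mono k)) as [M [M0 HM]];
      [now apply laurent_mono|].
    induction HG as [l Hl|a G G' _ IH _ IH'|Gk G _ IH Hu].
    + apply laurent_ext with (mono (exp_add k l)); [|now apply laurent_mono, HP].
      intros zs Hz; apply mono_exp_add; now apply (torus_neq0 n r).
    + apply laurent_ext with (fun zs => a * (mono k zs * G zs) + mono k zs * G' zs)%cx;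
        [intros; ring|now apply laurent_lin].
    + apply laurent_lim with (fun i zs => mono k zs * Gk i zs)%cx; [exact IH|].
      now apply unif_lim_mul_l with M.
  - apply laurent_ext with (fun zs => a * (F zs * G zs) + F' zs * G zs)%cx;
      [intros; ring|now apply laurent_lin].
  - destruct (laurent_bounded _ _ HG) as [M [M0 HM]].
    apply laurent_lim with (fun i zs => Fk i zs * G zs)%cx; [exact IH|].
    intros e He; destruct (unif_lim_mul_l G Fk F M M0 HM Hu e He) as [k0 H0].
    exists k0; intros k Hk zs Hz; specialize (H0 k Hk zs Hz).
    replace (Fk k zs * G zs - F zs * G zs)%cx with (G zs * Fk k zs - G zs * F zs)%cx by ring.
    exact H0.
Qed.

Lemma laurent_mul_level (s : Z) (m : nat) (c1 c2 : Z) (F G : list C -> C) :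
  laurent n r (level s m c1) F -> laurent n r (level s m c2) G ->
  laurent n r (level s m (c1 + c2)) (fun zs => F zs * G zs)%cx.
Proof. apply laurent_mul; unfold level, exp_add; intros; lia. Qed.

Lemma laurent_mul0 (s : Z) (m : nat) (F G : list C -> C) :
  laurent n r (level s m 0) F -> laurent n r (level s m 0) G ->
  laurent n r (level s m 0) (fun zs => F zs * G zs)%cx.
Proof. apply (laurent_mul_level s m 0 0). Qed.

(** Neumann series: level 0 is stable under products, so every partial sum stays in the class. *)
Lemma laurent_geom (s : Z) (m : nat) (u : list C -> C) (rho : R) :
  0 <= rho < 1 -> (forall zs, torus n r zs -> Cmod (u zs) <= rho) ->
  laurent n r (level s m 0) u -> laurent n r (level s m 0) (fun zs => / (C1 - u zs))%cx.
Proof.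
  intros Hrho Hu HL.
  (* Horner form of 1 + u + ... + u^i. Each step of the recursion multiplies the distance to the
     fixed point 1/(1-u) by u. *)
  set (S_ := fix S_ i zs := match i with O => C1 | S i => (C1 + u zs * S_ i zs)%cx end).
  apply laurent_lim with S_.
  - induction i as [|i IH]; simpl; [apply laurent_const|].
    apply laurent_add; [apply laurent_const|now apply laurent_mul0].
  - assert (forall zs, torus n r zs -> 1 - rho <= Cmod (C1 - u zs)%cx) as Hge.
    { intros zs Hz; specialize (Hu zs Hz).
      assert (Cmod (C1 - u zs + u zs)%cx <= Cmod (C1 - u zs)%cx + Cmod (u zs)) as H
        by apply Cmod_add.
      replace (C1 - u zs + u zs)%cx with C1 in H by ring. rewrite Cmod_C1 in H; lra. }
    assert (forall zs, torus n r zs -> (C1 - u zs)%cx <> C0) as Hne.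
    { intros zs Hz; apply Cmod_gt0_neq; specialize (Hge zs Hz); lra. }
    set (B := / (1 - rho)).
    assert (0 < B) by (apply Rinv_0_lt_compat; lra).
    assert (forall i zs, torus n r zs ->
              Cmod (S_ i zs - / (C1 - u zs))%cx <= rho ^ i * B) as Hb.
    { intros i zs Hz; induction i as [|i IH].
      - replace (S_ O zs - / (C1 - u zs))%cx with (- (u zs * / (C1 - u zs)))%cx
          by (simpl; field; now apply Hne).
        rewrite Cmod_opp, Cmod_mul, Cmod_inv by now apply Hne.
        simpl; apply Rmult_le_compat; auto using Cmod_ge0.
        + apply Rlt_le, Rinv_0_lt_compat; specialize (Hge zs Hz); lra.
        + specialize (Hu zs Hz); lra.
        + apply Rinv_le_contravar; [lra|now apply Hge].
      - replace (S_ (S i) zs - / (C1 - u zs))%cx with (u zs * (S_ i zs - / (C1 - u zs)))%cx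
          by (simpl; field; now apply Hne).
        rewrite Cmod_mul; simpl; rewrite Rmult_assoc.
        apply Rmult_le_compat; auto using Cmod_ge0. }
    intros e He.
    destruct (pow_lt_1_zero rho (ltac:(rewrite Rabs_pos_eq; lra)) (e / B)) as [k0 H0];
      [now apply Rdiv_lt_0_compat|].
    exists k0; intros k Hk zs Hz; eapply Rle_trans; [now apply Hb|].
    specialize (H0 k Hk); rewrite Rabs_pos_eq in H0 by (apply pow_le; lra).
    apply Rle_trans with (e / B * B); [|apply Req_le; field; lra].
    apply Rmult_le_compat_r; lra.
Qed.

Lemma laurent_nth (s : Z) (m j : nat) (c : Z) :
  (j < n)%nat -> (c <= s * unit_exp j 1 m)%Z -> laurent n r (level s m c) (fun zs => nth j zs C0).
Proof.
  intros Hj Hc; apply laurent_ext with (mono (unit_exp j 1)); [|now apply laurent_mono].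
  intros zs [Hl _]; rewrite mono_unit_exp by lia; apply Cpowz_1.
Qed.

Lemma laurent_inv_nth (s : Z) (m j : nat) (c : Z) :
  (j < n)%nat -> (c <= s * unit_exp j (-1) m)%Z ->
  laurent n r (level s m c) (fun zs => / nth j zs C0)%cx.
Proof.
  intros Hj Hc; apply laurent_ext with (mono (unit_exp j (-1))); [|now apply laurent_mono].
  intros zs [Hl _]; rewrite mono_unit_exp by lia; apply Cpowz_m1.
Qed.

End Laurent.

Lemma laurent_tl (n : nat) (r : R) (P Q : (nat -> Z) -> Prop) (F : list C -> C) :
  (forall k, P k -> Q (exp_cons 0 k)) -> laurent n r P F ->
  laurent (S n) r Q (fun zs => F (tl zs)).
Proof.
  intros HP; induction 1 as [k Hk|a F G _ IH _ IH'|Fk F _ IH Hu].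
  - apply laurent_ext with (mono (exp_cons 0 k)); [|now apply laurent_mono, HP].
    intros [|z zs] [Hl _]; [discriminate|].
    simpl; change (fun i => k i) with k; change (Cpowz z 0) with C1; ring.
  - now apply (laurent_lin _ _ _ a (fun zs => F (tl zs)) (fun zs => G (tl zs))).
  - apply laurent_lim with (fun i zs => Fk i (tl zs)); [exact IH|].
    intros e He; destruct (Hu e He) as [k0 H0]; exists k0; intros k Hk [|z zs] Hz.
    + destruct Hz; discriminate.
    + apply torus_cons in Hz as [_ Hz]; now apply H0.
Qed.

(** * Averages of limits of Laurent polynomials *)

Fixpoint const_coef (n : nat) (k : nat -> Z) : C :=
  match n with
  | O => C1
  | S n => ((if Z.eqb (k O) 0 then C1 else C0) * const_coef n (fun i => k (S i)))%cx
  end.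

Lemma const_coef_0 (n m : nat) (k : nat -> Z) :
  (m < n)%nat -> k m <> 0%Z -> const_coef n k = C0.
Proof.
  revert m k; induction n as [|n IH]; intros [|m] k Hm Hk; simpl; try lia.
  - destruct (Z.eqb_spec (k O) 0); [contradiction|ring].
  - rewrite (IH m); [ring|lia|exact Hk].
Qed.

Fixpoint swap {T : Type} (j : nat) (l : list T) : list T :=
  match j, l with
  | O, a :: b :: t => b :: a :: t
  | S j, a :: t => a :: swap j t
  | _, _ => l
  end.

Fixpoint exp_swap (j : nat) (k : nat -> Z) : nat -> Z :=
  match j with
  | O => exp_cons (k 1%nat) (exp_cons (k 0%nat) (fun i => k (S (S i))))
  | S j => exp_cons (k O) (exp_swap j (fun i => k (S i)))
  end.

Lemma mono_swap (j : nat) (k : nat -> Z) (zs : list C) :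
  (S j < length zs)%nat -> mono k (swap j zs) = mono (exp_swap j k) zs.
Proof.
  revert k zs; induction j as [|j IH]; intros k [|a [|b t]] H; simpl in *; try lia.
  - ring.
  - rewrite IH by (simpl; lia). reflexivity.
Qed.

Lemma const_coef_exp_swap (n j : nat) (k : nat -> Z) :
  (S j < n)%nat -> const_coef n (exp_swap j k) = const_coef n k.
Proof.
  revert n k; induction j as [|j IH]; intros [|n] k H; try lia.
  - destruct n as [|n]; [lia|]. simpl; ring.
  - simpl. f_equal. apply (IH n (fun i => k (S i))); lia.
Qed.

Lemma torus_swap (n : nat) (r : R) (j : nat) (zs : list C) :
  torus n r zs -> torus n r (swap j zs).
Proof.
  revert n zs; induction j as [|j IH]; intros [|n] [|a t] H; try (destruct H; discriminate);
    try exact H.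
  - destruct n as [|n], t as [|b t]; try exact H.
    + destruct H; discriminate.
    + simpl. rewrite !torus_cons in *. tauto.
  - simpl; rewrite torus_cons in *; split; [tauto|]. now apply IH.
Qed.

Section Means.
Variables (n : nat) (r : R).
Hypothesis Hr : 0 < r.

Lemma has_mean_mono (k : nat -> Z) : has_mean n r (mono k) (const_coef n k).
Proof.
  revert k; induction n as [|n' IH]; intros k.
  - apply has_mean_ext with (fun _ => C1); [lra| |apply (has_mean_const 0)].
    intros [|z zs] [H _]; [reflexivity|discriminate].
  - apply has_mean_ext with
      (fun l => Cpowz (hd C0 l) (k O) * mono (fun i => k (S i)) (tl l))%cx; [lra| |].
    + intros [|z zs] [H _]; [discriminate|reflexivity].
    + simpl; destruct (is_RInt_Cpowz_circ r (k O) _ Hr eq_refl) as [H1 H2].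
      now apply (has_mean_sep n' r (fun z => Cpowz z (k O))).
Qed.

Lemma unif_lim_swap (j : nat) (Fk : nat -> list C -> C) (F : list C -> C) :
  unif_lim n r Fk F -> unif_lim n r (fun i zs => Fk i (swap j zs)) (fun zs => F (swap j zs)).
Proof.
  intros Hu e He; destruct (Hu e He) as [k0 H0]; exists k0; intros k Hk zs Hz.
  now apply H0, torus_swap.
Qed.

(** Stands in for Fubini. For a monomial both averages are the constant coefficient, which does not
    see the order of the exponents; linear combinations and limits follow. *)
Lemma laurent_mean_swap (P : (nat -> Z) -> Prop) (F : list C -> C) (j : nat) :
  (S j < n)%nat -> laurent n r P F ->
  exists v, has_mean n r F v /\ has_mean n r (fun zs => F (swap j zs)) v.
Proof.
  intros Hj; induction 1 as [k Hk|a F G _ [v [Hv Hv']] _ [w [Hw Hw']]|Fk F _ IH Hu].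
  - exists (const_coef n k); split; [apply has_mean_mono|].
    apply has_mean_ext with (mono (exp_swap j k)); [lra| |].
    + intros zs [Hl _]; symmetry; apply mono_swap; lia.
    + rewrite <- (const_coef_exp_swap n j k Hj); apply has_mean_mono.
  - exists (a * v + w)%cx; split; [now apply has_mean_lin|].
    now apply (has_mean_lin n r a (fun zs => F (swap j zs)) (fun zs => G (swap j zs))).
  - destruct (IndefiniteDescription.functional_choice _ IH) as [vk Hvk].
    destruct (has_mean_lim n r Fk F vk) as [v Hv]; [lra|apply Hvk|exact Hu|].
    destruct (has_mean_lim n r (fun i zs => Fk i (swap j zs)) (fun zs => F (swap j zs)) vk)
      as [w Hw]; [lra|apply Hvk|now apply unif_lim_swap|].
    exists v; split; [exact Hv|].
    replace v with w; [exact Hw|].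
    symmetry; apply (has_mean_lim_eq n r Fk (fun i zs => Fk i (swap j zs)) F
                       (fun zs => F (swap j zs)) vk); auto; try lra; try apply Hvk.
    now apply unif_lim_swap.
Qed.

Lemma laurent_mean (P : (nat -> Z) -> Prop) (F : list C -> C) :
  laurent n r P F -> exists v, has_mean n r F v.
Proof.
  induction 1 as [k Hk|a F G _ [v Hv] _ [w Hw]|Fk F _ IH Hu].
  - exists (const_coef n k); apply has_mean_mono.
  - exists (a * v + w)%cx; now apply has_mean_lin.
  - destruct (IndefiniteDescription.functional_choice _ IH) as [vk Hvk].
    apply (has_mean_lim n r Fk F vk); auto; lra.
Qed.

(** Level 1 forces the exponent of variable m to be nonzero, with the same sign in all monomials, so
    there is no constant term. *)
Lemma laurent_mean0 (s : Z) (m : nat) (F : list C -> C) :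
  (m < n)%nat -> laurent n r (level s m 1) F -> has_mean n r F C0.
Proof.
  intros Hm; induction 1 as [k Hk|a F G _ IH _ IH'|Fk F _ IH Hu].
  - rewrite <- (const_coef_0 n m k Hm); [apply has_mean_mono|].
    intros E; unfold level in Hk; rewrite E in Hk; lia.
  - replace C0 with (a * C0 + C0)%cx by ring; now apply has_mean_lin.
  - destruct (has_mean_lim n r Fk F (fun _ => C0)) as [v Hv]; [lra|exact IH|exact Hu|].
    replace C0 with v; [exact Hv|].
    apply (has_mean_lim_eq n r Fk (fun _ _ => C0) F (fun _ => C0) (fun _ => C0));
      auto using has_mean_const; try lra.
    apply (unif_lim_const n r (fun _ => C0)); reflexivity.
Qed.

Lemma has_mean_antisym (P : (nat -> Z) -> Prop) (F : list C -> C) (j : nat) :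
  (S j < n)%nat -> laurent n r P F ->
  (forall zs, torus n r zs -> F (swap j zs) = (- F zs)%cx) -> has_mean n r F C0.
Proof.
  intros Hj HF HE; destruct (laurent_mean_swap P F j Hj HF) as [v [H1 H2]].
  replace C0 with v; [exact H1|].
  assert (has_mean n r (fun zs => F zs + F (swap j zs))%cx (v + v)%cx) as H3.
  { apply has_mean_ext with (fun zs => C1 * F zs + F (swap j zs))%cx;
      [lra|intros; ring|].
    replace (v + v)%cx with (C1 * v + v)%cx by ring. now apply has_mean_lin. }
  assert (v + v = C0)%cx as E.
  { apply (has_mean_unique _ _ _ _ _ H3).
    apply has_mean_ext with (fun _ => C0); [lra| |apply has_mean_const].
    intros zs Hz; rewrite HE by exact Hz; ring. }
  apply C_eq; [apply (f_equal Re) in E|apply (f_equal Im) in E]; simpl in *; lra.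
Qed.

End Means.

(** * Sums, powers and products of Laurent limits *)

Fixpoint Csum (n : nat) (f : nat -> C) : C :=
  match n with
  | O => C0
  | S n => (f O + Csum n (fun i => f (S i)))%cx
  end.

Lemma laurent_Csum (n : nat) (r : R) (s : Z) (m N : nat) (f : nat -> list C -> C) :
  (forall j, (j < N)%nat -> laurent n r (level s m 0) (f j)) ->
  laurent n r (level s m 0) (fun zs => Csum N (fun j => f j zs)).
Proof.
  revert f; induction N as [|N IH]; intros f H; simpl; [apply laurent_const|].
  apply laurent_add; [apply H; lia|].
  apply (IH (fun j => f (S j))); intros j Hj; apply H; lia.
Qed.

Lemma laurent_Cpown (n : nat) (r : R) (s : Z) (m j : nat) (F : list C -> C) :
  0 < r -> laurent n r (level s m 0) F ->
  laurent n r (level s m 0) (fun zs => Cpown (F zs) j).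
Proof.
  intros Hr HF; induction j as [|j IH]; simpl; [apply laurent_const|].
  now apply laurent_mul0.
Qed.

Lemma map_nth_seq {T : Type} (f : C -> T) (l : list C) :
  map f l = map (fun j => f (nth j l C0)) (seq 0 (length l)).
Proof.
  induction l as [|z l IH]; [reflexivity|].
  simpl; f_equal; rewrite IH at 1. rewrite <- seq_shift, map_map; reflexivity.
Qed.

(** [g] selects the variables over which the product runs: all of them, or the tail for a row of the
    kernel, where [f] also reads the first variable. *)
Lemma laurent_Cprod (n : nat) (r : R) (s : Z) (m N : nat) (f : list C -> C -> C)
    (g : list C -> list C) :
  0 < r -> (forall zs, torus n r zs -> length (g zs) = N) ->
  (forall j, (j < N)%nat -> laurent n r (level s m 0) (fun zs => f zs (nth j (g zs) C0))) ->
  laurent n r (level s m 0) (fun zs => Cprod (map (f zs) (g zs))).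
Proof.
  intros Hr Hg Hf.
  apply laurent_ext with (fun zs => Cprod (map (fun j => f zs (nth j (g zs) C0)) (seq 0 N))).
  - intros zs Hz; rewrite (map_nth_seq _ (g zs)), Hg by exact Hz; reflexivity.
  - assert (forall L, (forall j, In j L -> (j < N)%nat) -> laurent n r (level s m 0)
      (fun zs => Cprod (map (fun j => f zs (nth j (g zs) C0)) L))) as H.
    { induction L as [|j L IH]; intros HL; simpl; [apply laurent_const|].
      apply laurent_mul0; [exact Hr|apply Hf, HL; now left|apply IH; intros; apply HL; now right]. }
    apply H; intros j Hj; apply in_seq in Hj; lia.
Qed.

(** * Initial condition *)

Definition qker (q : R) (z w : C) : C :=
  ((z - w) / (z - RtoC q * w - RtoC (1 - q) * (z * w)))%cx.

Definition qrow (q : R) (z : C) (t : list C) : C := Cprod (map (qker q z) t).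

(** The kernel K arranged by rows, so that dropping the first variable leaves the kernel of the
    others; [qprod_pairs] relates it to the product over [pairs_lt]. *)
Fixpoint qprod (q : R) (zs : list C) : C :=
  match zs with
  | nil => C1
  | z :: t => (qrow q z t * qprod q t)%cx
  end.

Definition geo (zs : list C) : C := Cprod (map (fun z => / (C1 - z))%cx zs).

Section Kernel.
Variables (q r : R).
Hypothesis Hq : 0 < Rabs q < 1.
Hypothesis Hr : 0 < r < (1 - Rabs q) / Rabs (1 - q).

Lemma abs_1q_pos : 0 < Rabs (1 - q).
Proof.
  apply Rabs_pos_lt; intros E. assert (q = 1) as -> by lra. rewrite Rabs_R1 in Hq; lra.
Qed.

Lemma contraction_lt1 : 0 <= Rabs q + Rabs (1 - q) * r < 1.
Proof.
  generalize abs_1q_pos; intros H.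
  assert (Rabs (1 - q) * r < Rabs (1 - q) * ((1 - Rabs q) / Rabs (1 - q)))
    by (apply Rmult_lt_compat_l; lra).
  replace (Rabs (1 - q) * ((1 - Rabs q) / Rabs (1 - q))) with (1 - Rabs q) in H0
    by (field; lra).
  assert (0 < Rabs (1 - q) * r) by (apply Rmult_lt_0_compat; lra). lra.
Qed.

(** As |q| + |1-q| >= 1, a radius of at least 1 would contradict [contraction_lt1]. *)
Lemma radius_lt1 : r < 1.
Proof.
  generalize abs_1q_pos contraction_lt1; intros H H1.
  assert (1 <= Rabs (1 - q) + Rabs q).
  { rewrite <- Rabs_R1 at 1. replace 1 with (1 - q + q) at 1 by ring. apply Rabs_triang. }
  nra.
Qed.

Lemma one_minus_neq0 (z : C) : Cmod z = r -> (C1 - z)%cx <> C0.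
Proof.
  intros Hz E; generalize radius_lt1; intros H1.
  assert (z = C1) as E1 by (replace z with (C1 - (C1 - z))%cx by ring; rewrite E; ring).
  rewrite E1, Cmod_C1 in Hz; lra.
Qed.

(** The denominator of [qker] is z times 1 - [qratio]; on the torus this ratio has modulus at most
    |q| + |1-q| r. *)
Definition qratio (z w : C) : C := (RtoC q * (w * / z) + RtoC (1 - q) * w)%cx.

Lemma qratio_bound (z w : C) :
  Cmod z = r -> Cmod w = r -> Cmod (qratio z w) <= Rabs q + Rabs (1 - q) * r.
Proof.
  intros Hz Hw. assert (z <> C0) by (apply Cmod_gt0_neq; lra).
  eapply Rle_trans; [apply Cmod_add|].
  rewrite !Cmod_mul, Cmod_inv, !Cmod_RtoC, Hz, Hw by assumption.
  apply Req_le; field; lra.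
Qed.

Lemma one_minus_qratio_neq0 (z w : C) : Cmod z = r -> Cmod w = r -> (C1 - qratio z w)%cx <> C0.
Proof.
  intros Hz Hw E. generalize (qratio_bound z w Hz Hw) contraction_lt1; intros H H1.
  assert (qratio z w = C1) as E1
    by (replace (qratio z w) with (C1 - (C1 - qratio z w))%cx by ring; rewrite E; ring).
  rewrite E1, Cmod_C1 in H; lra.
Qed.

Lemma qker_den (z w : C) : z <> C0 ->
  (z - RtoC q * w - RtoC (1 - q) * (z * w))%cx = (z * (C1 - qratio z w))%cx.
Proof. intros Hz; unfold qratio; field; exact Hz. Qed.

Lemma qker_den_neq0 (z w : C) : Cmod z = r -> Cmod w = r ->
  (z - RtoC q * w - RtoC (1 - q) * (z * w))%cx <> C0.
Proof.
  intros Hz Hw. assert (z <> C0) as H0 by (apply Cmod_gt0_neq; lra).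
  rewrite qker_den by exact H0. intros E; apply (one_minus_qratio_neq0 z w Hz Hw).
  replace (C1 - qratio z w)%cx with (/ z * (z * (C1 - qratio z w)))%cx by (field; exact H0).
  rewrite E; ring.
Qed.

Section Membership.
Variables (n : nat) (s : Z) (m i j : nat).
Hypotheses (Hi : (i < n)%nat) (Hj : (j < n)%nat).
Hypothesis Hmj : (0 <= s * unit_exp j 1 m)%Z.
Hypothesis Hmij : (0 <= s * (unit_exp j 1 m + unit_exp i (-1) m))%Z.

Lemma laurent_quot :
  laurent n r (level s m 0) (fun zs => nth j zs C0 * / nth i zs C0)%cx.
Proof.
  apply laurent_ext with (mono (exp_add (unit_exp j 1) (unit_exp i (-1)))).
  - intros zs Hz; rewrite mono_exp_add by (apply (torus_neq0 n r); [lra|exact Hz]).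
    destruct Hz as [Hl _]; rewrite !mono_unit_exp by lia. now rewrite Cpowz_1, Cpowz_m1.
  - now apply laurent_mono.
Qed.

(** [qratio] combines z_j/z_i and z_j. [Hmij] and [Hmj] say that exactly these two monomials have
    level 0, and the geometric series inherits it. *)
Lemma laurent_inv_1_qratio :
  laurent n r (level s m 0) (fun zs => / (C1 - qratio (nth i zs C0) (nth j zs C0)))%cx.
Proof.
  apply laurent_geom with (Rabs q + Rabs (1 - q) * r); [lra|apply contraction_lt1| |].
  - intros zs Hz; apply qratio_bound; eapply torus_nth; eauto.
  - apply laurent_add; apply laurent_scal; [apply laurent_quot|now apply laurent_nth].
Qed.

Lemma laurent_qker :
  laurent n r (level s m 0) (fun zs => qker q (nth i zs C0) (nth j zs C0)).
Proof.
  apply laurent_ext with (fun zs => (C1 - nth j zs C0 * / nth i zs C0) *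
                                    / (C1 - qratio (nth i zs C0) (nth j zs C0)))%cx.
  - intros zs Hz. assert (Cmod (nth i zs C0) = r) as H1 by (eapply torus_nth; eauto).
    assert (Cmod (nth j zs C0) = r) as H2 by (eapply torus_nth; eauto).
    assert (nth i zs C0 <> C0) as H3 by (apply Cmod_gt0_neq; lra).
    unfold qker; rewrite qker_den by exact H3. field; split; [|exact H3].
    now apply one_minus_qratio_neq0.
  - apply laurent_mul0; [lra| |apply laurent_inv_1_qratio].
    apply laurent_sub; [apply laurent_const|apply laurent_quot].
Qed.

End Membership.

Lemma nth_tl (zs : list C) (j : nat) : nth j (tl zs) C0 = nth (S j) zs C0.
Proof. destruct zs, j; reflexivity. Qed.

Lemma hd_nth (zs : list C) : hd C0 zs = nth 0 zs C0.
Proof. destruct zs; reflexivity. Qed.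

Lemma length_tl_torus (n : nat) (zs : list C) : torus (S n) r zs -> length (tl zs) = n.
Proof. intros [H _]; destruct zs; simpl in *; lia. Qed.

Lemma laurent_geo (n : nat) (s : Z) (m : nat) :
  (0 <= s)%Z -> laurent n r (level s m 0) geo.
Proof.
  intros Hs. apply (laurent_Cprod n r s m n (fun _ z => / (C1 - z))%cx (fun zs => zs)).
  - lra.
  - intros zs [H _]; exact H.
  - intros j Hj; apply laurent_geom with r; [lra|generalize radius_lt1; lra| |].
    + intros zs Hz; apply Req_le; eapply torus_nth; eauto.
    + apply laurent_nth; [exact Hj|]; unfold unit_exp; destruct (Nat.eqb m j); lia.
Qed.

(** In the second alternative m is the last index. That variable is the second member of every pair
    containing it, hence enters only through z_j and z_j/z_i, with nonnegative powers. *)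
Lemma laurent_qprod (n : nat) (s : Z) (m : nat) :
  s = 0%Z \/ (s = 1%Z /\ n = S m) -> laurent n r (level s m 0) (qprod q).
Proof.
  revert m s; induction n as [|n IH]; intros m s Hs.
  - apply laurent_ext with (fun _ => C1); [|apply laurent_const].
    intros [|z zs] [H _]; [reflexivity|discriminate].
  - apply laurent_ext with (fun zs => qrow q (hd C0 zs) (tl zs) * qprod q (tl zs))%cx.
    { intros [|z zs] [H _]; [discriminate|reflexivity]. }
    apply laurent_mul0; [lra| |].
    + apply (laurent_Cprod (S n) r s m n (fun zs => qker q (hd C0 zs)) (@tl C));
        [lra|intros zs Hz; now apply length_tl_torus|].
      intros j Hj.
      apply laurent_ext with (fun zs => qker q (nth 0 zs C0) (nth (S j) zs C0)).
      { intros zs _; now rewrite nth_tl, hd_nth. }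
      apply laurent_qker; try lia; unfold unit_exp;
        destruct (Nat.eqb_spec m (S j)), (Nat.eqb_spec m 0); lia.
    + destruct n as [|n].
      * apply laurent_tl with (level 0 0 0); [|apply IH; now left].
        intros k _; unfold level, exp_cons.
        destruct m; [lia|]. destruct Hs as [->|[_ E]]; [lia|discriminate].
      * destruct m as [|m].
        { apply laurent_tl with (level s 0 0); [|apply IH; left].
          - intros k _; unfold level, exp_cons; lia.
          - destruct Hs as [E|[_ E]]; [exact E|discriminate]. }
        { apply laurent_tl with (level s m 0); [|apply IH].
          - intros k H; exact H.
          - destruct Hs as [E|[E1 E2]]; [now left|right; split; [exact E1|lia]]. }
Qed.

Lemma has_mean_last (n : nat) (a : nat -> Z) :
  (1 <= a n)%Z -> has_mean (S n) r (fun zs => qprod q zs * geo zs * mono a zs)%cx C0.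
Proof.
  intros Ha; apply laurent_mean0 with 1%Z n; [lra|lia|].
  apply (laurent_mul_level (S n) r (proj1 Hr) 1 n 0 1).
  - apply laurent_mul0; [lra|apply laurent_qprod; auto|apply laurent_geo; lia].
  - apply laurent_mono; unfold level; lia.
Qed.

(* Replaces the residue at infinity: with [z] the first variable,
   [(1 - 1/z) / (1 - z) = - 1/z], so only the term [1] of [F] contributes to the mean
   of [F / (1 - z)]. *)
Definition near_one (n : nat) (F : list C -> C) : Prop :=
  exists G, laurent (S n) r (level (-1) 0 0) G /\
    forall zs, torus (S n) r zs -> F zs = (C1 + (C1 - / hd C0 zs) * G zs)%cx.

Lemma laurent_inv_hd (n : nat) (c : Z) :
  (c <= 1)%Z -> laurent (S n) r (level (-1) 0 c) (fun zs => / hd C0 zs)%cx.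
Proof.
  intros Hc; apply laurent_ext with (fun zs => / nth 0 zs C0)%cx.
  - intros zs _; now rewrite hd_nth.
  - apply laurent_inv_nth; [lia|]; unfold unit_exp; simpl; lia.
Qed.

Lemma near_one_const (n : nat) : near_one n (fun _ => C1).
Proof.
  exists (fun _ => C0); split; [apply laurent_const|intros; ring].
Qed.

Lemma near_one_mul (n : nat) (F G : list C -> C) :
  near_one n F -> near_one n G -> near_one n (fun zs => F zs * G zs)%cx.
Proof.
  intros [F' [HF EF]] [G' [HG EG]].
  (* With u = 1 - 1/z: (1 + u F') (1 + u G') = 1 + u (F' + G' + u F' G'), and u has only nonpositive
     powers of z. *)
  exists (fun zs => F' zs + G' zs + (C1 - / hd C0 zs) * (F' zs * G' zs))%cx; split.
  - apply laurent_add; [now apply laurent_add|].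
    apply laurent_mul0; [lra| |apply laurent_mul0; auto; lra].
    apply laurent_sub; [apply laurent_const|apply laurent_inv_hd; lia].
  - intros zs Hz; rewrite EF, EG by exact Hz; ring.
Qed.

(** Numerator minus denominator of [qker q z w] is (1-q) w (z-1). Dividing by z (1 - [qratio]) gives
    the witness (1-q) w / (1 - [qratio]), where z occurs only through w/z and so with nonpositive
    powers. *)
Lemma near_one_qrow (n : nat) : near_one n (fun zs => qrow q (hd C0 zs) (tl zs)).
Proof.
  assert (forall j, (j < n)%nat ->
    near_one n (fun zs => qker q (nth 0 zs C0) (nth (S j) zs C0))) as Hj.
  { intros j Hj.
    exists (fun zs => RtoC (1 - q) * nth (S j) zs C0 *
                      / (C1 - qratio (nth 0 zs C0) (nth (S j) zs C0)))%cx; split.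
    - apply laurent_mul0; [lra| |].
      + apply laurent_scal, laurent_nth; [lia|]; unfold unit_exp; simpl; lia.
      + apply laurent_inv_1_qratio; try lia; unfold unit_exp; simpl; lia.
    - intros zs Hz; rewrite hd_nth.
      assert (Cmod (nth 0 zs C0) = r) as H1 by (eapply torus_nth; [eauto|lia]).
      assert (Cmod (nth (S j) zs C0) = r) as H2 by (eapply torus_nth; [eauto|lia]).
      assert (nth 0 zs C0 <> C0) as H3 by (apply Cmod_gt0_neq; lra).
      generalize (one_minus_qratio_neq0 _ _ H1 H2); intros H4.
      unfold qker; rewrite qker_den by exact H3.
      set (z := nth 0 zs C0) in *. set (w := nth (S j) zs C0) in *.
      replace (z - w)%cx with (z * (C1 - qratio z w) + (z - C1) * (RtoC (1 - q) * w))%cx.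
      + field; split; assumption.
      + unfold qratio; rewrite !RtoC_sub; change (RtoC 1) with C1; field; exact H3. }
  assert (forall L, (forall j, In j L -> (j < n)%nat) ->
    near_one n (fun zs => Cprod (map (fun j => qker q (nth 0 zs C0) (nth (S j) zs C0)) L)))
    as HL.
  { induction L as [|j L IH]; intros HL; simpl; [apply near_one_const|].
    apply (near_one_mul n (fun zs => qker q (nth 0 zs C0) (nth (S j) zs C0)));
      [apply Hj, HL; now left|apply IH; intros; apply HL; now right]. }
  destruct (HL (seq 0 n)) as [G [HG EG]]; [intros j Hi; apply in_seq in Hi; lia|].
  exists G; split; [exact HG|]; intros zs Hz; rewrite <- EG by exact Hz.
  unfold qrow; rewrite map_nth_seq, (length_tl_torus n) by exact Hz.
  f_equal; apply map_ext; intros j; now rewrite nth_tl, hd_nth.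
Qed.

Lemma near_one_inv_pow (n : nat) (k : nat) :
  near_one n (fun zs => Cpowz (hd C0 zs) (- Z.of_nat k)).
Proof.
  induction k as [|k IH]; [apply near_one_const|].
  destruct (near_one_mul n (fun zs => / hd C0 zs)%cx
    (fun zs => Cpowz (hd C0 zs) (- Z.of_nat k))) with (2 := IH) as [G [HG EG]].
  (* 1/z = 1 + (1 - 1/z) (-1). *)
  - exists (fun _ => - C1)%cx; split; [apply laurent_const|intros; ring].
  - exists G; split; [exact HG|]; intros zs Hz; rewrite <- EG by exact Hz.
    rewrite !Cpowz_opp_of_nat; simpl.
    assert (hd C0 zs <> C0) as H0.
    { rewrite hd_nth; apply Cmod_gt0_neq; rewrite (torus_nth (S n) r) by (auto; lia); lra. }
    field; split; [now apply Cpown_neq0|exact H0].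
Qed.

Lemma has_mean_first (n : nat) (a : nat -> Z) (v : C) :
  (a O <= 0)%Z ->
  has_mean n r (fun zs => qprod q zs * geo zs * mono (fun i => a (S i)) zs)%cx v ->
  has_mean (S n) r (fun zs => qprod q zs * geo zs * mono a zs)%cx v.
Proof.
  intros Ha Hv. set (B := fun zs => (qprod q zs * geo zs * mono (fun i => a (S i)) zs)%cx) in *.
  destruct (near_one_mul n _ _ (near_one_qrow n) (near_one_inv_pow n (Z.to_nat (- a O))))
    as [G [HG EG]].
  replace (- Z.of_nat (Z.to_nat (- a O)))%Z with (a O) in EG by lia.
  assert (forall s, laurent (S n) r (level s 0 0) (fun zs => B (tl zs))) as HB.
  { intros s; apply laurent_tl with (level 0 0 0).
    - intros k _; unfold level, exp_cons; lia.
    - apply laurent_mul0; [lra| |apply laurent_mono; unfold level; lia].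
      apply laurent_mul0; [lra|apply laurent_qprod; now left|apply laurent_geo; lia]. }
  (* The z-dependent part is (1 + (1 - 1/z) G) / (1 - z) = z/(1-z) - G/z + 1. The first term has
     only positive powers of z and the second only negative ones, so both average to zero; the term
     1 leaves [B] in the remaining variables. *)
  apply has_mean_ext with (fun zs => C1 *
      (B (tl zs) * (nth 0 zs C0 * / (C1 - nth 0 zs C0))) +
      ((- C1) * ((B (tl zs) * G zs) * / hd C0 zs) + B (tl zs)))%cx.
  - lra.
  - intros [|z t] Hz; [destruct Hz; discriminate|]. specialize (EG _ Hz).
    simpl hd in EG; simpl tl in EG. simpl hd; simpl tl; simpl nth; simpl qprod; simpl mono.
    apply torus_cons in Hz as [Hz _].
    change (geo (z :: t)) with (/ (C1 - z) * geo t)%cx.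
    transitivity (B t * (/ (C1 - z)) * (qrow q z t * Cpowz z (a O)))%cx;
      [|unfold B; ring].
    rewrite EG. field; split; [apply Cmod_gt0_neq; lra|now apply one_minus_neq0].
  - replace v with (C1 * C0 + ((- C1) * C0 + v))%cx by ring.
    apply (has_mean_lin (S n) r C1
             (fun zs => (B (tl zs) * (nth 0 zs C0 * / (C1 - nth 0 zs C0)))%cx)).
    + apply laurent_mean0 with 1%Z 0%nat; [lra|lia|].
      apply (laurent_mul_level (S n) r (proj1 Hr) 1 0 0 1); [apply HB|].
      apply (laurent_mul_level (S n) r (proj1 Hr) 1 0 1 0).
      * apply laurent_nth; [lia|]; unfold unit_exp; simpl; lia.
      * apply laurent_geom with r; [lra|generalize radius_lt1; lra| |].
        { intros zs Hz; apply Req_le; eapply torus_nth; [eauto|lia]. }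
        { apply laurent_nth; [lia|]; unfold unit_exp; simpl; lia. }
    + apply (has_mean_lin (S n) r (- C1)%cx
               (fun zs => ((B (tl zs) * G zs) * / hd C0 zs)%cx) (fun zs => B (tl zs)));
        [|now apply has_mean_tl].
      apply laurent_mean0 with (-1)%Z 0%nat; [lra|lia|].
      apply (laurent_mul_level (S n) r (proj1 Hr) (-1) 0 0 1); [|apply laurent_inv_hd; lia].
      apply laurent_mul0; [lra|apply HB|exact HG].
Qed.

Lemma has_mean_all_npos (n : nat) (a : nat -> Z) :
  (forall i, (i < n)%nat -> (a i <= 0)%Z) ->
  has_mean n r (fun zs => qprod q zs * geo zs * mono a zs)%cx C1.
Proof.
  revert a; induction n as [|n IH]; intros a Ha.
  - apply has_mean_ext with (fun _ => C1); [lra| |apply has_mean_const].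
    intros [|z zs] [H _]; [unfold geo; simpl; ring|discriminate].
  - apply has_mean_first; [apply Ha; lia|]. apply IH; intros i Hi; apply Ha; lia.
Qed.

(** Maximality of the last exponent makes the two cases, last exponent at least 1 and all exponents
    nonpositive, exhaustive. The factor 1 - prod z_i then subtracts the indicator of a_n + 1 <= 0
    from that of a_n <= 0. *)
Lemma has_mean_initial (n : nat) (a : nat -> Z) :
  (forall i, (i <= n)%nat -> (a i <= a n)%Z) ->
  has_mean (S n) r (fun zs => qprod q zs * geo zs * (C1 - Cprod zs) * mono a zs)%cx
    (if Z.eqb (a n) 0 then C1 else C0).
Proof.
  intros Ha.
  assert (forall b : nat -> Z, (forall i, (i <= n)%nat -> (b i <= b n)%Z) ->
    has_mean (S n) r (fun zs => qprod q zs * geo zs * mono b zs)%cx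
      (if Z.leb (b n) 0 then C1 else C0)) as H.
  { intros b Hb; destruct (Z.leb_spec (b n) 0).
    - apply has_mean_all_npos; intros i Hi; specialize (Hb i ltac:(lia)); lia.
    - apply has_mean_last; lia. }
  apply has_mean_ext with (fun zs => (- C1) * (qprod q zs * geo zs * mono (fun i => a i + 1)%Z zs)
                                     + qprod q zs * geo zs * mono a zs)%cx.
  - lra.
  - intros zs Hz.
    change (fun i => a i + 1)%Z with (exp_add a (fun _ => 1%Z)).
    rewrite mono_exp_add by (apply (torus_neq0 (S n) r); [lra|exact Hz]).
    assert (mono (fun _ => 1%Z) zs = Cprod zs) as ->; [|ring].
    clear; induction zs as [|z zs IH]; simpl; [reflexivity|].
    rewrite IH. now change (Cpowz z 1) with (z * C1)%cx; replace (z * C1)%cx with z by ring.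
  - replace (if Z.eqb (a n) 0 then C1 else C0) with
      ((- C1) * (if Z.leb (a n + 1) 0 then C1 else C0) + (if Z.leb (a n) 0 then C1 else C0))%cx.
    + apply has_mean_lin; [|now apply H].
      apply (H (fun i => a i + 1)%Z). intros i Hi; specialize (Ha i Hi); lia.
    + destruct (Z.eqb_spec (a n) 0), (Z.leb_spec (a n + 1) 0), (Z.leb_spec (a n) 0);
        try lia; ring.
Qed.

End Kernel.

Definition Rsuml (l : list R) : R := fold_right Rplus 0 l.

Lemma Rsuml_app (l l' : list R) : Rsuml (l ++ l') = Rsuml l + Rsuml l'.
Proof. induction l as [|a l IH]; simpl; [ring|]. unfold Rsuml in *; simpl; rewrite IH; ring. Qed.

(** * The generator on clusters *)

Definition pairing (D : list (R * list Z)) (f : list Z -> R) : R :=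
  Rsuml (map (fun p => fst p * f (snd p)) D).

Definition generator (q : R) (f : list Z -> R) (X : list Z) : R :=
  Rsuml (map (fun m => fst m * (f (snd m) - f X)) (moves q X)).

(** Duality between the forward generator on measures and the backward one on functions; the
    diagonal entry of [gen_step] supplies the term - f X of each difference. *)
Lemma pairing_gen_step (q : R) (D : list (R * list Z)) (f : list Z -> R) :
  pairing (gen_step q D) f = pairing D (generator q f).
Proof.
  induction D as [|[w X] D IH]; [reflexivity|].
  unfold gen_step; simpl flat_map.
  change (flat_map _ D) with (gen_step q D).
  unfold pairing in *; cbn [map app fst snd]; rewrite map_app; unfold Rsuml in *; cbn [map fold_right fst snd].
  change (fold_right Rplus 0) with Rsuml in *.
  rewrite Rsuml_app, IH, <- Rplus_assoc; f_equal.
  unfold generator, total_rate; change (fold_right Rplus 0) with Rsuml.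
  induction (moves q X) as [|[v X'] L IHL]; unfold Rsuml in *; simpl in *; [ring|].
  lra.
Qed.

Lemma pairing_distn (q : R) (n : nat) (Y : list Z) (f : list Z -> R) :
  pairing (distn q n Y) f = Nat.iter n (generator q) f Y.
Proof.
  revert f; induction n as [|n IH]; intros f.
  - unfold pairing, distn, Rsuml; simpl; ring.
  - change (distn q (S n) Y) with (gen_step q (distn q n Y)).
    rewrite pairing_gen_step, IH, Nat.iter_succ_r; reflexivity.
Qed.

Definition leftmost_at (x : Z) (X : list Z) : R := if Z.eqb (hd 0%Z X) x then 1 else 0.

Lemma coef_iter (q : R) (n : nat) (Y : list Z) (x : Z) :
  coef q n Y x = Nat.iter n (generator q) (leftmost_at x) Y.
Proof.
  rewrite <- pairing_distn; unfold coef, pairing, Rsuml; f_equal; apply map_ext.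
  intros [w X]; unfold leftmost_at; simpl; destruct (Z.eqb (hd 0%Z X) x); ring.
Qed.

(** The test of [moves], repeated literally so that [RtoC_generator] holds by conversion. *)
Definition cluster_end (X : list Z) (i : nat) : bool :=
  (Nat.eqb (S i) (length X) || negb (Z.eqb (nth (S i) X 0%Z) (nth i X 0%Z)))%bool.

(** Recursion on the tail is sound because [cluster_end] looks only to the right of its index. *)
Fixpoint end_sum (X : list Z) (G : nat -> C) : C :=
  match X with
  | nil => C0
  | y :: X' => ((if cluster_end X 0 then G O else C0) + end_sum X' (fun i => G (S i)))%cx
  end.

Lemma end_sum_ext (X : list Z) (G H : nat -> C) :
  (forall i, (i < length X)%nat -> cluster_end X i = true -> G i = H i) ->
  end_sum X G = end_sum X H.
Proof.
  revert G H; induction X as [|y X IH]; intros G H E; [reflexivity|].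
  cbn [end_sum]; f_equal.
  - destruct (cluster_end (y :: X) 0) eqn:Hc; [|reflexivity].
    apply E; [simpl; lia|exact Hc].
  - apply IH; intros i Hi Hc; apply E; [simpl; lia|exact Hc].
Qed.

Lemma end_sum_add (X : list Z) (G H : nat -> C) :
  (end_sum X (fun i => G i + H i) = end_sum X G + end_sum X H)%cx.
Proof.
  revert G H; induction X as [|y X IH]; intros G H; cbn [end_sum]; [ring|].
  rewrite (IH (fun i => G (S i)) (fun i => H (S i))).
  destruct (cluster_end (y :: X) 0); ring.
Qed.

Lemma end_sum_scal (X : list Z) (a : C) (G : nat -> C) :
  (end_sum X (fun i => a * G i) = a * end_sum X G)%cx.
Proof.
  revert G; induction X as [|y X IH]; intros G; cbn [end_sum]; [ring|].
  rewrite (IH (fun i => G (S i))). destruct (cluster_end (y :: X) 0); ring.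
Qed.

Lemma RtoC_sum_cluster_ends (X : list Z) (h : nat -> R * list Z) (g : R * list Z -> R) :
  RtoC (Rsuml (map g (flat_map (fun i => if cluster_end X i then [h i] else [])
                         (seq 0 (length X))))) =
  end_sum X (fun i => RtoC (g (h i))).
Proof.
  revert h; induction X as [|y X IH]; intros h; [reflexivity|].
  cbn [end_sum length seq flat_map].
  rewrite map_app, Rsuml_app, RtoC_add; f_equal.
  - destruct (cluster_end (y :: X) 0); unfold Rsuml; simpl; [f_equal; ring|reflexivity].
  - rewrite <- (IH (fun i => h (S i))), <- seq_shift.
    f_equal; f_equal; f_equal. rewrite !flat_map_concat_map, map_map; reflexivity.
Qed.

Definition jump (i : nat) (X : list Z) : list Z :=
  firstn i X ++ (nth i X 0 + 1)%Z :: skipn (S i) X.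

Lemma RtoC_generator (q : R) (f : list Z -> R) (X : list Z) :
  RtoC (generator q f X) =
  end_sum X (fun i => RtoC (qint q (count_occ Z.eq_dec X (nth i X 0%Z)) *
                            (f (jump i X) - f X))).
Proof.
  apply (RtoC_sum_cluster_ends X
    (fun i => (qint q (count_occ Z.eq_dec X (nth i X 0%Z)), jump i X))
    (fun m => fst m * (f (snd m) - f X))).
Qed.

Lemma qint_S (q : R) (k : nat) : qint q (S k) = qint q k + q ^ k.
Proof.
  unfold qint; rewrite seq_S, map_app.
  change (fold_right Rplus 0) with Rsuml; rewrite Rsuml_app; unfold Rsuml; simpl; ring.
Qed.

Lemma Sorted_count_head (y z : Z) (X : list Z) :
  Sorted Z.le (y :: z :: X) -> y <> z -> count_occ Z.eq_dec (z :: X) y = 0%nat.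
Proof.
  intros Hs Hn; apply count_occ_not_In; intros Hin.
  inversion Hs as [|? ? Hs' Hh]; subst; inversion Hh; subst.
  apply Sorted_StronglySorted in Hs'; [|intros a b c; apply Z.le_trans].
  inversion Hs' as [|? ? _ Hf]; subst. rewrite Forall_forall in Hf.
  destruct Hin as [->|Hin]; [congruence|specialize (Hf y Hin); lia].
Qed.

(** The reference value in a cluster is that of its last entry, the particle that jumps; entries
    further left carry higher powers of q. *)
Definition geometric_in_clusters (q : R) (X : list Z) (D : nat -> C) : Prop :=
  forall p, (S p < length X)%nat -> nth p X 0%Z = nth (S p) X 0%Z -> D p = (RtoC q * D (S p))%cx.

Lemma geometric_tl (q : R) (y : Z) (X : list Z) (D : nat -> C) :
  geometric_in_clusters q (y :: X) D -> geometric_in_clusters q X (fun i => D (S i)).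
Proof. intros H p Hp E; apply (H (S p)); [simpl; lia|exact E]. Qed.

(** Only the end of the cluster of [y] contributes to the sum. Writing the value of [D] there as a
    sum avoids naming its index and lets it merge with other sums over cluster ends. *)
Lemma end_sum_head (q : R) (y : Z) (X : list Z) (D : nat -> C) :
  Sorted Z.le (y :: X) -> geometric_in_clusters q (y :: X) D ->
  D O = (RtoC (q ^ (count_occ Z.eq_dec X y)) *
         end_sum (y :: X) (fun i => if Z.eqb (nth i (y :: X) 0%Z) y then D i else C0))%cx.
Proof.
  revert y D; induction X as [|z X IH]; intros y D Hs Hg.
  - simpl; rewrite Z.eqb_refl; change (RtoC 1) with C1; ring.
  - destruct (Z.eq_dec y z) as [<-|Hn].
    + assert (Sorted Z.le (y :: X)) as Hs' by now inversion Hs.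
      rewrite (Hg O) by (simpl; auto; lia).
      rewrite (IH y (fun i => D (S i)) Hs' (geometric_tl _ _ _ _ Hg)) at 1.
      rewrite count_occ_cons_eq by reflexivity.
      remember (y :: X) as X'. cbn [end_sum].
      assert (cluster_end (y :: X') 0 = false) as ->.
      { subst X'; unfold cluster_end; simpl; now rewrite Z.eqb_refl. }
      simpl pow; rewrite RtoC_mul; subst X'; simpl nth; ring.
    + rewrite Sorted_count_head by assumption.
      cbn [end_sum].
      assert (cluster_end (y :: z :: X) 0 = true) as ->.
      { unfold cluster_end; simpl. apply Z.eqb_neq in Hn; rewrite Z.eqb_sym, Hn; reflexivity. }
      change (nth 0 (y :: z :: X) 0%Z) with y; rewrite Z.eqb_refl.
      change ((if cluster_end (z :: X) 0 then _ else C0) + _)%cx with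
        (end_sum (z :: X) (fun i => if Z.eqb (nth i (z :: X) 0%Z) y then D (S i) else C0)).
      (* Written as a product so that [end_sum_scal] pulls out the zero. *)
      rewrite (end_sum_ext _ _ (fun _ => C0 * C0)%cx).
      * rewrite end_sum_scal; simpl; change (RtoC 1) with C1; ring.
      * intros i Hi _; destruct (Z.eqb_spec (nth i (z :: X) 0%Z) y) as [E|]; [|ring].
        exfalso. assert (In y (z :: X)) as Hin by (rewrite <- E; now apply nth_In).
        apply (count_occ_In Z.eq_dec) in Hin; rewrite Sorted_count_head in Hin by assumption; lia.
Qed.

Lemma Csum_end_sum (q : R) (X : list Z) (D : nat -> C) :
  Sorted Z.le X -> geometric_in_clusters q X D ->
  Csum (length X) D =
  end_sum X (fun i => RtoC (qint q (count_occ Z.eq_dec X (nth i X 0%Z))) * D i)%cx.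
Proof.
  revert D; induction X as [|y X IH]; intros D Hs Hg; [reflexivity|].
  assert (Sorted Z.le X) as HsX by now inversion Hs.
  cbn [length Csum]; rewrite (IH (fun i => D (S i)) HsX (geometric_tl _ _ _ _ Hg)).
  assert (forall i, (i < length X)%nat -> nth i X 0%Z <> y ->
    count_occ Z.eq_dec (y :: X) (nth i X 0%Z) = count_occ Z.eq_dec X (nth i X 0%Z)) as Hc.
  { intros i Hi Hn; apply count_occ_cons_neq; congruence. }
  destruct X as [|z X].
  - cbn [end_sum]; unfold cluster_end, qint; simpl.
    destruct (Z.eq_dec y y); [|congruence]; simpl.
    replace (1 + 0) with 1 by ring; change (RtoC 1) with C1; ring.
  - remember (z :: X) as X'. cbn [end_sum].
    destruct (Z.eq_dec y z) as [<-|Hn].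
    + assert (cluster_end (y :: X') 0 = false) as ->.
      { subst X'; unfold cluster_end; simpl; now rewrite Z.eqb_refl. }
      set (k := count_occ Z.eq_dec X y).
      assert (count_occ Z.eq_dec X' y = S k) as Hk
        by (subst X'; now apply count_occ_cons_eq).
      (* Adding [y] to its own cluster raises the rate there by q^(k+1), by [qint_S]; this surplus
         times the value at the cluster end is exactly the new term D 0. *)
      rewrite (end_sum_ext X' (fun i =>
          RtoC (qint q (count_occ Z.eq_dec (y :: X') (nth (S i) (y :: X') 0%Z))) * D (S i))%cx
        (fun i => RtoC (qint q (count_occ Z.eq_dec X' (nth i X' 0%Z))) * D (S i) +
        RtoC (q ^ S k) * (if Z.eqb (nth i X' 0%Z) y then D (S i) else C0))%cx).
      * rewrite end_sum_add, end_sum_scal.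
        rewrite (Hg O) by (subst X'; simpl; auto; lia).
        assert (D 1%nat = (RtoC (q ^ k) * end_sum X'
                  (fun i => if Z.eqb (nth i X' 0%Z) y then D (S i) else C0))%cx) as ->.
        { subst X'; apply (end_sum_head q y X (fun i => D (S i)) HsX (geometric_tl _ _ _ _ Hg)). }
        simpl pow; rewrite RtoC_mul; ring.
      * intros i Hi _; change (nth (S i) (y :: X') 0%Z) with (nth i X' 0%Z).
        destruct (Z.eqb_spec (nth i X' 0%Z) y) as [E|E].
        { rewrite E, count_occ_cons_eq, Hk, qint_S, RtoC_add by reflexivity; ring. }
        { rewrite Hc by assumption; ring. }
    + assert (cluster_end (y :: X') 0 = true) as ->.
      { subst X'; unfold cluster_end; simpl. apply Z.eqb_neq in Hn; rewrite Z.eqb_sym, Hn.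
        reflexivity. }
      assert (count_occ Z.eq_dec X' y = 0%nat) as H0
        by (subst X'; now apply Sorted_count_head).
      f_equal.
      * simpl nth. rewrite count_occ_cons_eq, H0 by reflexivity.
        unfold qint; simpl; replace (1 + 0) with 1 by ring; change (RtoC 1) with C1; ring.
      * apply end_sum_ext; intros i Hi _.
        change (nth (S i) (y :: X') 0%Z) with (nth i X' 0%Z). rewrite Hc; auto.
        intros E. assert (In y X') as Hin by (rewrite <- E; now apply nth_In).
        apply (count_occ_In Z.eq_dec) in Hin; lia.
Qed.

Lemma jump_cons (i : nat) (y : Z) (X : list Z) : jump (S i) (y :: X) = y :: jump i X.
Proof. reflexivity. Qed.

Lemma length_jump (i : nat) (X : list Z) : (i < length X)%nat -> length (jump i X) = length X.
Proof.
  intros H; unfold jump; rewrite length_app; cbn [length].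
  rewrite length_firstn, length_skipn; lia.
Qed.

Lemma nth_jump (i j : nat) (X : list Z) : (i < length X)%nat ->
  nth j (jump i X) 0%Z = (nth j X 0 + (if Nat.eqb j i then 1 else 0))%Z.
Proof.
  revert i j; induction X as [|y X IH]; intros i j H; [simpl in H; lia|].
  destruct i as [|i].
  - destruct j as [|j]; [reflexivity|]. simpl; lia.
  - rewrite jump_cons; destruct j as [|j]; [simpl; lia|].
    cbn [nth]; rewrite IH by (simpl in H; lia). reflexivity.
Qed.

Lemma Sorted_jump (i : nat) (X : list Z) :
  (i < length X)%nat -> cluster_end X i = true -> Sorted Z.le X -> Sorted Z.le (jump i X).
Proof.
  revert i; induction X as [|y X IH]; intros i Hi Hc Hs; [simpl in Hi; lia|].
  inversion Hs as [|? ? Hs' Hh]; subst.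
  destruct i as [|i].
  - change (jump 0 (y :: X)) with ((y + 1)%Z :: X); constructor; [exact Hs'|].
    destruct X as [|z X]; constructor. inversion Hh; subst.
    unfold cluster_end in Hc; simpl in Hc.
    destruct (Z.eqb_spec z y); simpl in Hc; [discriminate|lia].
  - rewrite jump_cons; constructor.
    + apply IH; [simpl in Hi; lia|exact Hc|exact Hs'].
    + destruct X as [|z X]; [simpl in Hi; lia|]. inversion Hh; subst.
      destruct i as [|i]; constructor; simpl in *; lia.
Qed.

(** * Sums and products under reversal and exchange of variables *)

Lemma Csum_ext (n : nat) (f g : nat -> C) :
  (forall i, (i < n)%nat -> f i = g i) -> Csum n f = Csum n g.
Proof.
  revert f g; induction n as [|n IH]; intros f g H; simpl; [reflexivity|].
  rewrite (H O) by lia; f_equal; apply IH; intros i Hi; apply H; lia.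
Qed.

Lemma Csum_last (n : nat) (f : nat -> C) : Csum (S n) f = (Csum n f + f n)%cx.
Proof.
  revert f; induction n as [|n IH]; intros f; [simpl; ring|].
  change (Csum (S (S n)) f) with (f O + Csum (S n) (fun i => f (S i)))%cx.
  rewrite IH; simpl; ring.
Qed.

Lemma Csum_rev (n : nat) (f : nat -> C) : Csum n f = Csum n (fun p => f (n - 1 - p)%nat).
Proof.
  induction n as [|n IH]; [reflexivity|].
  rewrite Csum_last, IH; simpl. replace (n - 0 - 0)%nat with n by lia.
  rewrite (Csum_ext n (fun i => f (n - 0 - S i)%nat) (fun p => f (n - 1 - p)%nat));
    [ring|intros i Hi; f_equal; lia].
Qed.

Lemma Csum_scal (n : nat) (a : C) (f : nat -> C) :
  (a * Csum n f = Csum n (fun i => a * f i))%cx.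
Proof.
  revert f; induction n as [|n IH]; intros f; simpl; [ring|].
  rewrite <- (IH (fun i => f (S i))); ring.
Qed.

Lemma Csum_nth_swap (n j : nat) (f : C -> C) (zs : list C) :
  length zs = n -> Csum n (fun i => f (nth i (swap j zs) C0)) = Csum n (fun i => f (nth i zs C0)).
Proof.
  revert n zs; induction j as [|j IH]; intros [|n] [|a t] H; try discriminate; try reflexivity.
  - destruct n as [|n], t as [|b t]; try discriminate; try reflexivity.
    simpl; ring.
  - simpl; f_equal; apply IH; simpl in H; lia.
Qed.

Lemma Permutation_swap {T : Type} (j : nat) (l : list T) : Permutation (swap j l) l.
Proof.
  revert l; induction j as [|j IH]; intros [|a [|b t]]; simpl; auto; try constructor; apply IH.
Qed.

Lemma Cprod_perm (l l' : list C) : Permutation l l' -> Cprod l = Cprod l'.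
Proof.
  induction 1; simpl; try congruence; ring.
Qed.

Lemma Cprod_map_swap (j : nat) (f : C -> C) (l : list C) :
  Cprod (map f (swap j l)) = Cprod (map f l).
Proof. apply Cprod_perm, Permutation_map, Permutation_swap. Qed.

Lemma mono_ext (k l : nat -> Z) (zs : list C) :
  (forall i, (i < length zs)%nat -> k i = l i) -> mono k zs = mono l zs.
Proof.
  revert k l; induction zs as [|z zs IH]; intros k l H; [reflexivity|].
  simpl; rewrite (H O) by (simpl; lia); f_equal.
  apply IH; intros i Hi; apply H; simpl; lia.
Qed.

Lemma exp_swap_id (j : nat) (k : nat -> Z) : k j = k (S j) -> forall i, exp_swap j k i = k i.
Proof.
  revert k; induction j as [|j IH]; intros k H i.
  - destruct i as [|[|i]]; simpl; auto.
  - destruct i as [|i]; [reflexivity|]. apply (IH (fun i => k (S i)) H i).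
Qed.

Lemma has_mean_Csum (n : nat) (r : R) (N : nat) (f : nat -> list C -> C) (v : nat -> C) :
  (forall i, (i < N)%nat -> has_mean n r (f i) (v i)) ->
  has_mean n r (fun zs => Csum N (fun i => f i zs)) (Csum N v).
Proof.
  revert f v; induction N as [|N IH]; intros f v H; simpl; [apply has_mean_const|].
  replace (v O + Csum N (fun i => v (S i)))%cx with (C1 * v O + Csum N (fun i => v (S i)))%cx
    by ring.
  destruct (has_mean_lin n r C1 (f O) (fun zs => Csum N (fun i => f (S i) zs)) _ _
              (H O ltac:(lia)) (IH (fun i => f (S i)) (fun i => v (S i))
                                  (fun i Hi => H (S i) ltac:(lia)))) as [H1 H2].
  split; [eapply iter_int_eq; [exact H1|intros l|]|eapply iter_int_eq; [exact H2|intros l|]]; simpl; ring.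
Qed.

(** * Contact relation and moments *)

Section Chain.
Variables (q r : R).
Hypothesis Hq : 0 < Rabs q < 1.
Hypothesis Hr : 0 < r < (1 - Rabs q) / Rabs (1 - q).

(** With k_i = x - y_i this is the integrand of J_0: the exponent -1 of the contour integrand is
    absorbed by dz = i z dθ. *)
Definition weight (k : nat -> Z) (zs : list C) : C :=
  (qprod q zs * geo zs * (C1 - Cprod zs) * mono k zs)%cx.

Definition eps_sum (n : nat) (zs : list C) : C := Csum n (fun i => eps (nth i zs C0)).

Definition moment (n : nat) (k : nat -> Z) (m : nat) (zs : list C) : C :=
  (weight k zs * Cpown (eps_sum n zs) m)%cx.

Lemma laurent_eps_nth (n i : nat) :
  (i < n)%nat -> laurent n r (level 0 0 0) (fun zs => eps (nth i zs C0)).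
Proof.
  intros Hi; apply laurent_sub; [apply laurent_inv_nth; lia|apply laurent_const].
Qed.

Lemma laurent_weight (n : nat) (k : nat -> Z) : laurent n r (level 0 0 0) (weight k).
Proof.
  apply laurent_mul0; [lra| |apply laurent_mono; unfold level; lia].
  apply laurent_mul0; [lra| |].
  - apply laurent_mul0; [lra|apply laurent_qprod; auto|apply (laurent_geo q); auto; lia].
  - apply laurent_sub; [apply laurent_const|].
    apply laurent_ext with (fun zs => Cprod (map (fun z => z) zs)).
    + intros zs _; now rewrite map_id.
    + apply (laurent_Cprod n r 0 0 n (fun _ z => z) (fun zs => zs));
        [lra|intros zs [H _]; exact H|intros j Hj; apply laurent_nth; lia].
Qed.

Lemma laurent_eps_sum (n : nat) : laurent n r (level 0 0 0) (eps_sum n).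
Proof.
  apply (laurent_Csum n r 0 0 n (fun j zs => eps (nth j zs C0))).
  intros j Hj; now apply laurent_eps_nth.
Qed.

Lemma laurent_moment (n : nat) (k : nat -> Z) (m : nat) :
  laurent n r (level 0 0 0) (moment n k m).
Proof.
  apply laurent_mul0; [lra|apply laurent_weight|].
  apply laurent_Cpown; [lra|apply laurent_eps_sum].
Qed.

Lemma weight_shift (n : nat) (k : nat -> Z) (i : nat) (zs : list C) :
  (i < n)%nat -> torus n r zs ->
  weight (exp_add k (unit_exp i (-1))) zs = (weight k zs * / nth i zs C0)%cx.
Proof.
  intros Hi Hz; unfold weight.
  rewrite mono_exp_add by (apply (torus_neq0 n r); [lra|exact Hz]).
  destruct Hz as [Hl _]; rewrite mono_unit_exp, Cpowz_m1 by lia; ring.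
Qed.

(** Two readings: the denominator of [qker] for the pair (j, j+1) divided by the product of both
    variables, and the combination eps z_{j+1} - q eps z_j. *)
Definition contact (j : nat) (zs : list C) : C :=
  (/ nth (S j) zs C0 - RtoC q * / nth j zs C0 - RtoC (1 - q))%cx.

(** Exchanging adjacent variables only permutes the kernel factors that involve a third variable.
    The remaining factor times [contact] is (a - b)/(ab), which is antisymmetric. *)
Lemma qprod_contact_swap (n j : nat) (zs : list C) :
  (S j < n)%nat -> torus n r zs ->
  (qprod q (swap j zs) * contact j (swap j zs) = - (qprod q zs * contact j zs))%cx.
Proof.
  revert n zs; induction j as [|j IH]; intros n zs Hj Hz.
  - destruct zs as [|a [|b t]]; [destruct Hz as [H _]; simpl in H; lia..|].
    destruct n as [|[|n]]; try lia. rewrite !torus_cons in Hz.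
    destruct Hz as [Ha [Hb _]].
    assert (forall a b, Cmod a = r -> Cmod b = r ->
      (qker q a b * contact 0 (a :: b :: t) = (a - b) * / (a * b))%cx) as E.
    { clear - Hr Hq; intros a b Ha Hb.
      assert (a <> C0) by (apply Cmod_gt0_neq; lra).
      assert (b <> C0) by (apply Cmod_gt0_neq; lra).
      generalize (qker_den_neq0 q r Hq Hr a b Ha Hb); intros H1.
      unfold qker, contact; cbn [nth].
      field_simplify_eq; [ring|auto]. }
    assert (a <> C0) by (apply Cmod_gt0_neq; lra).
    assert (b <> C0) by (apply Cmod_gt0_neq; lra).
    change (swap 0 (a :: b :: t)) with (b :: a :: t).
    cbn [qprod]; unfold qrow; cbn [map Cprod fold_right]; fold (Cprod (map (qker q a) t)).
    fold (Cprod (map (qker q b) t)).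
    set (X := Cprod (map (qker q a) t)); set (Y := Cprod (map (qker q b) t)).
    transitivity ((qker q b a * contact 0 (b :: a :: t)) * (X * Y * qprod q t))%cx; [ring|].
    transitivity (- ((qker q a b * contact 0 (a :: b :: t)) * (X * Y * qprod q t)))%cx; [|ring].
    rewrite !E by assumption; field; auto.
  - destruct zs as [|a t]; [destruct Hz as [H _]; simpl in H; lia|].
    destruct n as [|n]; [lia|]. apply torus_cons in Hz as [Ha Hz].
    change (swap (S j) (a :: t)) with (a :: swap j t).
    change (contact (S j) (a :: swap j t)) with (contact j (swap j t)).
    change (contact (S j) (a :: t)) with (contact j t).
    cbn [qprod]; unfold qrow; rewrite Cprod_map_swap.
    set (X := Cprod (map (qker q a) t)).
    transitivity (X * (qprod q (swap j t) * contact j (swap j t)))%cx; [ring|].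
    rewrite (IH n t) by (auto; lia); ring.
Qed.

(** The factors outside the kernel and [contact] are symmetric in the two variables, the monomial
    because its two exponents agree. *)
Lemma moment_contact_mean (n : nat) (k : nat -> Z) (m j : nat) :
  (S j < n)%nat -> k j = k (S j) ->
  has_mean n r (fun zs => moment n k m zs * contact j zs)%cx C0.
Proof.
  intros Hj Hk; apply has_mean_antisym with (level 0 0 0) j; [lra|exact Hj| |].
  - apply laurent_mul0; [lra|apply laurent_moment|].
    apply laurent_sub; [|apply laurent_const].
    apply laurent_sub; [apply laurent_inv_nth; lia|].
    apply laurent_scal, laurent_inv_nth; lia.
  - intros zs Hz. generalize (qprod_contact_swap n j zs Hj Hz); intros E.
    assert (length zs = n) as Hl by apply Hz.
    unfold moment, weight, eps_sum.
    rewrite (Csum_nth_swap n j eps zs Hl).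
    rewrite mono_swap by lia; rewrite (mono_ext _ k) by (intros i _; now apply exp_swap_id).
    unfold geo; rewrite Cprod_map_swap.
    rewrite (Cprod_perm _ _ (Permutation_swap j zs)).
    set (X := Cpown _ m). set (g := Cprod (map _ zs)).
    transitivity ((qprod q (swap j zs) * contact j (swap j zs)) *
                  (g * (C1 - Cprod zs) * mono k zs * X))%cx; [ring|].
    rewrite E; ring.
Qed.

Lemma moment_eps_adjacent (n : nat) (k : nat -> Z) (m j : nat) (v w : C) :
  (S j < n)%nat -> k j = k (S j) ->
  has_mean n r (fun zs => moment n k m zs * eps (nth j zs C0))%cx v ->
  has_mean n r (fun zs => moment n k m zs * eps (nth (S j) zs C0))%cx w ->
  w = (RtoC q * v)%cx.
Proof.
  intros Hj Hk Hv Hw.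
  assert (has_mean n r (fun zs => moment n k m zs * contact j zs)%cx (- (RtoC q) * v + w)%cx)
    as H.
  { apply has_mean_ext with (fun zs => - (RtoC q) * (moment n k m zs * eps (nth j zs C0)) +
                                       moment n k m zs * eps (nth (S j) zs C0))%cx.
    - lra.
    - intros zs _; unfold contact, eps; rewrite RtoC_sub; change (RtoC 1) with C1; ring.
    - now apply has_mean_lin. }
  generalize (has_mean_unique _ _ _ _ _ H (moment_contact_mean n k m j Hj Hk)); intros E.
  replace w with ((- (RtoC q) * v + w) + RtoC q * v)%cx by ring. rewrite E; ring.
Qed.

(** [Y] is stored from y_N to y_1 but the variables from z_1 to z_N, hence the reversed index. *)
Definition exponents (n : nat) (Y : list Z) (x : Z) : nat -> Z :=
  fun i => (x - nth (n - 1 - i) Y 0)%Z.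

Lemma exponents_jump (n : nat) (Y : list Z) (x : Z) (p : nat) :
  length Y = n -> (p < n)%nat ->
  forall i, (i < n)%nat ->
  exponents n (jump p Y) x i = exp_add (exponents n Y x) (unit_exp (n - 1 - p) (-1)) i.
Proof.
  intros Hl Hp i Hi; unfold exponents, exp_add, unit_exp.
  rewrite nth_jump by lia.
  destruct (Nat.eqb_spec (n - 1 - i) p), (Nat.eqb_spec i (n - 1 - p)); lia.
Qed.

Lemma Sorted_head_le_nth (Y : list Z) (p : nat) :
  Sorted Z.le Y -> (p < length Y)%nat -> (nth 0 Y 0 <= nth p Y 0)%Z.
Proof.
  intros Hs Hp; destruct Y as [|y Y]; [simpl in Hp; lia|].
  apply Sorted_StronglySorted in Hs; [|intros a b c; apply Z.le_trans].
  destruct p as [|p]; [simpl; lia|].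
  inversion Hs as [|? ? _ Hf]; subst. rewrite Forall_forall in Hf.
  cbn [nth]; apply Hf, nth_In; simpl in Hp; lia.
Qed.

(** The induction on m quantifies over all sorted [Y], because one application of the generator
    evaluates the previous step at every configuration reached by a jump. *)
Theorem moment_mean (n m : nat) (Y : list Z) (x : Z) :
  in_S (S n) Y ->
  has_mean (S n) r (moment (S n) (exponents (S n) Y x) m)
    (RtoC (Nat.iter m (generator q) (leftmost_at x) Y)).
Proof.
  revert Y; induction m as [|m IH]; intros Y [Hl Hs].
  - apply has_mean_ext with (weight (exponents (S n) Y x)).
    + lra.
    + intros zs _; unfold moment; simpl; ring.
    + simpl. replace (RtoC (leftmost_at x Y)) with
        (if Z.eqb (exponents (S n) Y x n) 0 then C1 else C0).
      * apply (has_mean_initial q r Hq Hr n); intros i Hi; unfold exponents.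
        replace (S n - 1 - n)%nat with O by lia.
        generalize (Sorted_head_le_nth Y (S n - 1 - i) Hs ltac:(lia)); lia.
      * unfold exponents, leftmost_at. replace (S n - 1 - n)%nat with O by lia.
        replace (hd 0%Z Y) with (nth 0 Y 0%Z) by (destruct Y; reflexivity).
        destruct (Z.eqb_spec (x - nth 0 Y 0%Z) 0), (Z.eqb_spec (nth 0 Y 0%Z) x);
          try lia; reflexivity.
  - set (N := S n) in *. set (k := exponents N Y x).
    (* The range condition sits under the existential so that choice yields a function on all
       indices. *)
    assert (forall i, exists v, (i < N)%nat ->
      has_mean N r (fun zs => moment N k m zs * eps (nth i zs C0))%cx v) as Hex.
    { intros i. destruct (le_lt_dec N i) as [Hi|Hi]; [exists C0; lia|].
      destruct (laurent_mean N r (proj1 Hr) (level 0 0 0)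
        (fun zs => moment N k m zs * eps (nth i zs C0))%cx) as [v Hv]; [|now exists v].
      apply laurent_mul0; [lra|apply laurent_moment|now apply laurent_eps_nth]. }
    destruct (IndefiniteDescription.functional_choice _ Hex) as [d Hd].
    change (Nat.iter (S m) (generator q) (leftmost_at x)) with
      (generator q (Nat.iter m (generator q) (leftmost_at x))).
    set (u := Nat.iter m (generator q) (leftmost_at x)) in *.
    replace (RtoC (generator q u Y)) with (Csum N d).
    + apply has_mean_ext with (fun zs => Csum N (fun i => moment N k m zs * eps (nth i zs C0)))%cx.
      * lra.
      * intros zs _; rewrite <- Csum_scal; fold (eps_sum N zs).
        unfold moment; simpl Cpown; ring.
      * now apply has_mean_Csum.
    (* Entry p of [Y] belongs to variable N - 1 - p. *)
    + assert (geometric_in_clusters q Y (fun p => d (N - 1 - p)%nat)) as Hg.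
      { intros p Hp E; rewrite Hl in Hp.
        apply (moment_eps_adjacent N k m (N - 1 - S p)).
        - lia.
        - unfold k, exponents.
          replace (N - 1 - (N - 1 - S p))%nat with (S p) by lia.
          replace (N - 1 - S (N - 1 - S p))%nat with p by lia. now rewrite E.
        - apply Hd; lia.
        - replace (S (N - 1 - S p)) with (N - 1 - p)%nat by lia; apply Hd; lia. }
      rewrite Csum_rev. rewrite <- Hl at 1; rewrite (Csum_end_sum q Y _ Hs Hg).
      rewrite RtoC_generator. apply end_sum_ext; intros p Hp Hc.
      rewrite RtoC_mul; f_equal.
      rewrite Hl in *. rewrite RtoC_sub.
      (* In eps z = 1/z - 1 the term 1/z lowers one exponent, which is a jump, and -1 subtracts the
         moment before the jump. The induction hypothesis needs a sorted list after the jump,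
         guaranteed here because p is a cluster end. *)
      apply (has_mean_unique N r (fun zs => moment N k m zs * eps (nth (N - 1 - p) zs C0))%cx);
        [apply Hd; lia|].
      assert (in_S N (jump p Y)) as HJ.
      { split; [rewrite length_jump; lia|]. apply Sorted_jump; auto; lia. }
      apply has_mean_ext with (fun zs => - C1 * moment N k m zs +
                                         moment N (exponents N (jump p Y) x) m zs)%cx.
      * lra.
      * intros zs Hz; unfold moment.
        replace (weight (exponents N (jump p Y) x) zs) with
          (weight (exp_add k (unit_exp (N - 1 - p) (-1))) zs).
        { rewrite (weight_shift N) by (auto; lia). unfold eps; ring. }
        unfold weight; f_equal. symmetry; apply mono_ext; intros i Hi.
        apply exponents_jump; auto; destruct Hz; lia.
      * replace (RtoC (u (jump p Y)) - RtoC (u Y))%cx with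
          (- C1 * RtoC (u Y) + RtoC (u (jump p Y)))%cx by ring.
        apply has_mean_lin; apply IH; [split; assumption|exact HJ].
Qed.

End Chain.

(** * Summing the exponential series *)

Lemma Cmod_Cpown (z : C) (n : nat) : Cmod (Cpown z n) = Cmod z ^ n.
Proof. induction n as [|n IH]; simpl; [apply Cmod_C1|now rewrite Cmod_mul, IH]. Qed.

Lemma Cmod_Cexp (z : C) : Cmod (Cexp z) = exp (Re z).
Proof.
  rewrite <- (Cmod_circ (exp (Re z)) (Im z)); [reflexivity|].
  apply Rlt_le, exp_pos.
Qed.

Lemma Cexp_add (z w : C) : Cexp (z + w)%cx = (Cexp z * Cexp w)%cx.
Proof.
  apply C_eq; simpl; rewrite exp_plus, ?cos_plus, ?sin_plus; ring.
Qed.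

Lemma Cexp_0 : Cexp C0 = C1.
Proof. apply C_eq; simpl; rewrite exp_0, ?cos_0, ?sin_0; ring. Qed.

(** A real function of s, to which the real Taylor formula applies on [0, 1]; differentiation
    multiplies [c] by [u]. Taking c = 1 or c = -i recovers the real or imaginary part of the
    exponential. *)
Definition exp_line (u c : C) (s : R) : R := Re (c * Cexp (RtoC s * u))%cx.

Lemma is_derive_exp_line (u c : C) (s : R) :
  is_derive (exp_line u c) s (exp_line u (c * u)%cx s).
Proof.
  unfold exp_line; simpl. auto_derive; [auto|]. unfold Rminus; ring.
Qed.

Lemma Derive_n_exp_line (u c : C) (k : nat) :
  Derive_n (exp_line u c) k = exp_line u (c * Cpown u k)%cx.
Proof.
  induction k as [|k IH]; apply functional_extensionality; intros s.
  - simpl; f_equal; ring.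
  - simpl Derive_n; rewrite IH, (is_derive_unique _ _ _ (is_derive_exp_line u _ s)).
    f_equal; simpl; ring.
Qed.

Definition exp_partial (u : C) (n : nat) : C :=
  Csum (S n) (fun m => RtoC (/ INR (fact m)) * Cpown u m)%cx.

Lemma sum_f_R0_Re (n : nat) (f : nat -> C) :
  sum_f_R0 (fun m => Re (f m)) n = Re (Csum (S n) f).
Proof.
  induction n as [|n IH]; [simpl; ring|].
  rewrite Csum_last; simpl sum_f_R0; rewrite IH; reflexivity.
Qed.

Lemma Im_Csum_RtoC (n : nat) (f : nat -> R) : Im (Csum n (fun m => RtoC (f m))) = 0.
Proof.
  revert f; induction n as [|n IH]; intros f; simpl; [reflexivity|].
  rewrite (IH (fun i => f (S i))); ring.
Qed.

Lemma exp_partial_Re_error (u c : C) (B : R) (n : nat) :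
  Cmod u <= B -> Cmod c <= 1 ->
  Rabs (Re (c * (Cexp u - exp_partial u n))%cx) <= exp B * (B ^ S n / INR (fact (S n))).
Proof.
  intros Hu Hc.
  assert (0 <= B) as HB by (eapply Rle_trans; [apply Cmod_ge0|exact Hu]).
  destruct (Taylor_Lagrange (exp_line u c) n 0 1) as [z [Hz E]]; [lra| |].
  { intros s _ [|k] _; [exact I|]. simpl. rewrite Derive_n_exp_line.
    eexists; apply is_derive_exp_line. }
  rewrite Rminus_0_r, pow1, Derive_n_exp_line in E.
  assert (exp_line u c 1 = Re (c * Cexp u)%cx) as E1.
  { unfold exp_line; do 2 f_equal. f_equal. apply C_eq; simpl; ring. }
  assert (sum_f_R0 (fun m => 1 ^ m / INR (fact m) * Derive_n (exp_line u c) m 0) n =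
          Re (c * exp_partial u n)%cx) as E2.
  { unfold exp_partial; rewrite Csum_scal, <- sum_f_R0_Re. apply sum_eq; intros m _.
    rewrite pow1, Derive_n_exp_line; unfold exp_line.
    replace (RtoC 0 * u)%cx with C0 by (apply C_eq; simpl; ring). rewrite Cexp_0.
    simpl; field; apply INR_fact_neq_0. }
  rewrite E1, E2 in E.
  replace (Re (c * (Cexp u - exp_partial u n))%cx) with
    (Re (c * Cexp u)%cx - Re (c * exp_partial u n)%cx) by (simpl; ring).
  rewrite E.
  replace (_ + 1 / INR (fact (S n)) * exp_line u (c * Cpown u (S n))%cx z - _) with
    (/ INR (fact (S n)) * exp_line u (c * Cpown u (S n))%cx z)
    by (field; apply INR_fact_neq_0).
  assert (0 < / INR (fact (S n))) as Hf by apply Rinv_0_lt_compat, INR_fact_lt_0.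
  rewrite Rabs_mult, (Rabs_pos_eq (/ _)) by lra.
  replace (exp B * (B ^ S n / INR (fact (S n)))) with
    (/ INR (fact (S n)) * (1 * B ^ S n * exp B)) by (unfold Rdiv; ring).
  apply Rmult_le_compat_l; [lra|].
  unfold exp_line; eapply Rle_trans; [apply Re_le_Cmod|].
  rewrite !Cmod_mul, Cmod_Cpown, Cmod_Cexp.
  apply Rmult_le_compat.
  - apply Rmult_le_pos; [apply Cmod_ge0|apply pow_le, Cmod_ge0].
  - apply Rlt_le, exp_pos.
  - apply Rmult_le_compat; auto using Cmod_ge0, pow_le. apply pow_incr; split; [apply Cmod_ge0|exact Hu].
  - assert (Re (RtoC z * u)%cx <= B) as Hle.
    { replace (Re (RtoC z * u)%cx) with (z * Re u) by (simpl; ring).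
      generalize (Re_le_Cmod u) (Rle_abs (Re u)); nra. }
    destruct Hle as [H|H]; [left; now apply exp_increasing|rewrite H; lra].
Qed.

Lemma exp_partial_error (u : C) (B : R) (n : nat) :
  Cmod u <= B ->
  Cmod (exp_partial u n - Cexp u)%cx <= 2 * exp B * (B ^ S n / INR (fact (S n))).
Proof.
  intros Hu. rewrite <- Cmod_opp. eapply Rle_trans; [apply Cmod_le_Re_Im|].
  generalize (exp_partial_Re_error u C1 B n Hu (Req_le _ _ Cmod_C1)); intros H1.
  assert (Cmod (- Ci)%cx <= 1) as Hi by (rewrite Cmod_opp; apply Req_le; exact Complex.Cmod_Ci).
  generalize (exp_partial_Re_error u (- Ci)%cx B n Hu Hi); intros H2.
  replace (Re (- (exp_partial u n - Cexp u))%cx) with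
    (Re (C1 * (Cexp u - exp_partial u n))%cx) by (simpl Re; ring).
  replace (Im (- (exp_partial u n - Cexp u))%cx) with
    (Re (- Ci * (Cexp u - exp_partial u n))%cx) by (simpl Re; simpl Im; ring).
  lra.
Qed.

(** * Rewriting the contour integrand and conclusion *)

Lemma Cpown_mul (z w : C) (n : nat) : Cpown (z * w)%cx n = (Cpown z n * Cpown w n)%cx.
Proof. induction n as [|n IH]; simpl; [ring|rewrite IH; ring]. Qed.

Lemma Cpown_RtoC (a : R) (n : nat) : Cpown (RtoC a) n = RtoC (a ^ n).
Proof. induction n as [|n IH]; simpl; [reflexivity|now rewrite IH, <- RtoC_mul]. Qed.

Lemma Cprod_map_scal (a : C) (r : R) (ths : list R) :
  Cprod (map (fun th => a * circ r th)%cx ths) =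
  (Cpown a (length ths) * Cprod (map (circ r) ths))%cx.
Proof.
  induction ths as [|th ths IH]; simpl; [ring|].
  fold (Cprod (map (fun th => a * circ r th)%cx ths)); rewrite IH.
  unfold Cprod; simpl; ring.
Qed.

Lemma map_seq_S {T : Type} (f : nat -> T) (a n : nat) :
  map f (seq (S a) n) = map (fun i => f (S i)) (seq a n).
Proof. now rewrite <- seq_shift, map_map. Qed.

Lemma Cprod_map_mul (f g : nat -> C) (l : list nat) :
  Cprod (map (fun i => f i * g i)%cx l) = (Cprod (map f l) * Cprod (map g l))%cx.
Proof.
  induction l as [|i l IH]; unfold Cprod in *; simpl; [ring|rewrite IH; ring].
Qed.

Lemma Cprod_Cexp (g : nat -> C) (n : nat) :
  Cprod (map (fun i => Cexp (g i)) (seq 0 n)) = Cexp (Csum n g).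
Proof.
  revert g; induction n as [|n IH]; intros g; [symmetry; apply Cexp_0|].
  cbn [seq map Csum]; rewrite Cexp_add, map_seq_S, <- (IH (fun i => g (S i))); reflexivity.
Qed.

Lemma Cprod_Cpowz (k : nat -> Z) (zs : list C) :
  Cprod (map (fun i => Cpowz (nth i zs C0) (k i)) (seq 0 (length zs))) = mono k zs.
Proof.
  revert k; induction zs as [|z zs IH]; intros k; [reflexivity|].
  cbn [length seq map mono]; rewrite map_seq_S, <- (IH (fun i => k (S i))); reflexivity.
Qed.

Lemma Cprod_flat_map {T : Type} (g : T -> C) (h : nat -> list T) (l : list nat) :
  Cprod (map g (flat_map h l)) = Cprod (map (fun i => Cprod (map g (h i))) l).
Proof.
  induction l as [|i l IH]; [reflexivity|].
  cbn [flat_map map]; rewrite map_app.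
  transitivity (Cprod (map g (h i)) * Cprod (map g (flat_map h l)))%cx; [|rewrite IH; reflexivity].
  generalize (map g (h i)); intros l1; induction l1 as [|z l1 IHl]; unfold Cprod in *; simpl; [ring|].
  rewrite IHl; ring.
Qed.

Lemma zi_cons (z : C) (zs : list C) (i : nat) : (1 <= i)%nat -> zi (z :: zs) (S i) = zi zs i.
Proof.
  intros Hi; unfold zi; destruct i as [|i]; [lia|].
  replace (S (S i) - 1)%nat with (S i) by lia. now replace (S i - 1)%nat with i by lia.
Qed.

Lemma qprod_pairs (q : R) (zs : list C) :
  Cprod (map (fun ij : nat * nat => let (i, j) := ij in qker q (zi zs i) (zi zs j))
           (pairs_lt (length zs))) = qprod q zs.
Proof.
  unfold pairs_lt; rewrite Cprod_flat_map.
  induction zs as [|z zs IH]; [reflexivity|].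
  cbn [length seq map qprod]. rewrite <- IH.
  unfold Cprod at 1; cbn [fold_right]; fold (Cprod (map (fun i => Cprod (map
    (fun ij : nat * nat => let (i0, j) := ij in qker q (zi (z :: zs) i0) (zi (z :: zs) j))
    (map (fun j => (i, j)) (seq (S i) (S (length zs) - i))))) (seq 2 (length zs)))).
  f_equal.
  - unfold qrow; rewrite map_map, (map_nth_seq (qker q z) zs).
    replace (S (length zs) - 1)%nat with (length zs) by lia.
    rewrite !map_seq_S; reflexivity.
  - rewrite map_seq_S; f_equal; apply map_ext_in; intros i Hi; apply in_seq in Hi.
    rewrite !map_map, map_seq_S. f_equal. apply map_ext_in; intros j Hj; apply in_seq in Hj.
    rewrite !zi_cons by lia; reflexivity.
Qed.

Lemma map_zi (zs : list C) : map (zi zs) (seq 1 (length zs)) = zs.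
Proof.
  transitivity (map (fun z => z) zs); [|apply map_id].
  rewrite map_seq_S, (map_nth_seq (fun z => z) zs); apply map_ext; intros i.
  unfold zi; now replace (S i - 1)%nat with i by lia.
Qed.

Lemma Cprod_inv (f : C -> C) (zs : list C) :
  Forall (fun z => f z <> C0) zs ->
  Cprod (map (fun z => / f z)%cx zs) = (/ Cprod (map f zs))%cx /\ Cprod (map f zs) <> C0.
Proof.
  induction 1 as [|z zs Hz _ [IH IH']]; unfold Cprod in *; simpl.
  - split; [symmetry; apply Cinv_C1|apply (F_1_neq_0 C_field)].
  - rewrite IH; split; [field; auto|].
    intros E; apply IH'.
    set (X := fold_right Cmul C1 (map f zs)) in *.
    replace X with (/ f z * (f z * X))%cx by (field; exact Hz). rewrite E; ring.
Qed.

Section Final.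
Variables (q r : R).
Hypothesis Hq : 0 < Rabs q < 1.
Hypothesis Hr : 0 < r < (1 - Rabs q) / Rabs (1 - q).

Lemma I_fun_eq (n : nat) (zs : list C) :
  torus n r zs -> I_fun n q zs = (qprod q zs * geo zs * (C1 - Cprod zs))%cx.
Proof.
  intros [Hl Hz]; unfold I_fun; subst n.
  rewrite map_zi, <- (map_map (zi zs) (fun z => C1 - z)%cx), map_zi.
  transitivity (qprod q zs * ((C1 - Cprod zs) / Cprod (map (fun z => C1 - z) zs)))%cx.
  - f_equal; apply qprod_pairs.
  - destruct (Cprod_inv (fun z => C1 - z)%cx zs) as [E H].
    { eapply Forall_impl; [|exact Hz]; intros z Hm; now apply (one_minus_neq0 q r Hq Hr). }
    unfold geo; rewrite E; field; exact H.
Qed.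

Definition full_weight (n : nat) (k : nat -> Z) (t : R) (zs : list C) : C :=
  (weight q k zs * Cexp (RtoC t * eps_sum n zs))%cx.

(** The factors i z of the parametrization meet the prefactor: i^n / (2πi)^n = (2π)^(-n), and the
    product of the z_i raises each exponent x - y_i - 1 by one. *)
Lemma integrand_eq (n : nat) (Y : list Z) (x : Z) (t : R) (ths : list R) :
  length ths = n ->
  (integrand n q Y x t (map (circ r) ths) * Cprod (map (fun th => Ci * circ r th) ths))%cx =
  (RtoC (/ (2 * PI) ^ n) * full_weight n (exponents n Y x) t (map (circ r) ths))%cx.
Proof.
  intros Hl; assert (torus n r (map (circ r) ths)) as Hz by (apply torus_circ; auto; lra).
  unfold integrand; rewrite (I_fun_eq n) by exact Hz.
  rewrite Cprod_map_scal, Hl.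
  set (zs := map (circ r) ths) in *.
  rewrite (Cprod_map_mul (fun i => Cpowz (zi zs i) (x - yi n Y i - 1))
             (fun i => Cexp (eps (zi zs i) * RtoC t)%cx)), !map_seq_S.
  assert (Cpown (/ (RtoC (2 * PI) * Ci)) n * Cpown Ci n = RtoC (/ (2 * PI) ^ n))%cx as E1.
  { rewrite <- Cpown_mul.
    replace (/ (RtoC (2 * PI) * Ci) * Ci)%cx with (RtoC (/ (2 * PI))).
    - rewrite Cpown_RtoC; f_equal; apply pow_inv.
    - unfold Cinv; apply C_eq; simpl; field; apply PI_neq0. }
  assert (Cprod (map (fun i => Cpowz (zi zs (S i)) (x - yi n Y (S i) - 1)) (seq 0 n)) *
          Cprod zs = mono (exponents n Y x) zs)%cx as E2.
  { destruct Hz as [Hlz Hzz].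
    assert (Forall (fun z => z <> C0) zs) as Hn by (apply (torus_neq0 n r); [lra|split; auto]).
    assert (Cprod zs = mono (fun _ => 1%Z) zs) as ->.
    { clear; induction zs as [|z zs' IH]; simpl; [reflexivity|].
      rewrite <- IH, Cpowz_1; reflexivity. }
    transitivity (mono (fun i => exponents n Y x i - 1)%Z zs * mono (fun _ => 1%Z) zs)%cx.
    - f_equal. rewrite <- Cprod_Cpowz, Hlz; f_equal; apply map_ext; intros i.
      unfold zi, yi, exponents.
      replace (S i - 1)%nat with i by lia. now replace (n - S i)%nat with (n - 1 - i)%nat by lia.
    - rewrite <- mono_exp_add by exact Hn. apply mono_ext; intros i _; unfold exp_add; lia. }
  assert (Cprod (map (fun i => Cexp (eps (zi zs (S i)) * RtoC t)%cx) (seq 0 n)) =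
          Cexp (RtoC t * eps_sum n zs)) as E3.
  { rewrite (Cprod_Cexp (fun i => eps (zi zs (S i)) * RtoC t)%cx); f_equal.
    unfold eps_sum; rewrite Csum_scal; apply Csum_ext; intros i _.
    unfold zi; replace (S i - 1)%nat with i by lia; ring. }
  rewrite E3, <- E1; unfold full_weight, weight; rewrite <- E2; ring.
Qed.

(** The partial sums of the probability series are the averages [vk] of the partial sums [Fk] of the
    exponential. Uniform convergence of [Fk] gives both the convergence of the series and its
    value. *)
Lemma full_weight_mean (n : nat) (Y : list Z) (x : Z) (t : R) :
  in_S (S n) Y ->
  exists p, prob_leftmost q Y x t p /\
    has_mean (S n) r (full_weight (S n) (exponents (S n) Y x) t) (RtoC p).
Proof.
  intros HY. set (N := S n) in *. set (k := exponents N Y x).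
  set (F := full_weight N k t).
  set (Fk := fun M zs => Csum (S M) (fun m => RtoC (t ^ m / INR (fact m)) * moment q N k m zs)%cx).
  set (vk := fun M => Csum (S M) (fun m => RtoC (coef q m Y x * t ^ m / INR (fact m)))).
  assert (forall M, has_mean N r (Fk M) (vk M)) as Hk.
  { intros M; apply has_mean_Csum; intros m _.
    apply has_mean_ext with (fun zs => RtoC (t ^ m / INR (fact m)) * moment q N k m zs + C0)%cx;
      [lra|intros; ring|].
    replace (RtoC (coef q m Y x * t ^ m / INR (fact m))) with
      (RtoC (t ^ m / INR (fact m)) * RtoC (coef q m Y x) + C0)%cx
      by (apply C_eq; simpl; unfold Rdiv; ring).
    apply has_mean_lin; [|apply has_mean_const].
    rewrite coef_iter; now apply moment_mean. }
  assert (unif_lim N r Fk F) as Hu.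
  { destruct (laurent_bounded N r (proj1 Hr) _ _ (laurent_weight q r Hq Hr N k))
      as [A [HA0 HA]].
    destruct (laurent_bounded N r (proj1 Hr) _ _ (laurent_eps_sum r N))
      as [B [HB0 HB]].
    set (B' := Rabs t * B).
    intros e He.
    (* [A] bounds the weight and 2 exp B' is the constant of [exp_partial_error]; A + 1 keeps the
       divisor positive when A = 0. *)
    assert (0 < 2 * exp B' * (A + 1)) as Hp
      by (apply Rmult_lt_0_compat; [generalize (exp_pos B')|]; lra).
    destruct (cv_speed_pow_fact B' (e / (2 * exp B' * (A + 1)))) as [k0 H0];
      [now apply Rdiv_lt_0_compat|].
    exists k0; intros M HM zs Hz.
    specialize (HA zs Hz); specialize (HB zs Hz).
    set (u := (RtoC t * eps_sum N zs)%cx).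
    assert (Cmod u <= B') as Hub.
    { unfold u, B'; rewrite Cmod_mul, Cmod_RtoC; apply Rmult_le_compat_l;
        [apply Rabs_pos|exact HB]. }
    assert (Fk M zs = weight q k zs * exp_partial u M)%cx as ->.
    { unfold Fk, exp_partial; rewrite Csum_scal; apply Csum_ext; intros m _.
      unfold moment, u; rewrite Cpown_mul, Cpown_RtoC. unfold Rdiv; rewrite RtoC_mul; ring. }
    change (F zs) with (weight q k zs * Cexp u)%cx.
    replace (weight q k zs * exp_partial u M - weight q k zs * Cexp u)%cx with
      (weight q k zs * (exp_partial u M - Cexp u))%cx by ring.
    rewrite Cmod_mul.
    specialize (H0 (S M) ltac:(lia)); unfold Rdist in H0; rewrite Rminus_0_r in H0.
    eapply Rle_trans.
    { apply Rmult_le_compat; [apply Cmod_ge0|apply Cmod_ge0|exact HA|].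
      exact (exp_partial_error u B' M Hub). }
    set (y := B' ^ S M / INR (fact (S M))) in *.
    apply Rle_trans with ((2 * exp B' * (A + 1)) * (e / (2 * exp B' * (A + 1))));
      [|apply Req_le; field; generalize (exp_pos B'); lra].
    assert (y <= e / (2 * exp B' * (A + 1))) as Hy by (generalize (Rle_abs y); lra).
    assert (0 <= y) as Hy0.
    { apply Rmult_le_pos; [apply pow_le, Rmult_le_pos; [apply Rabs_pos|exact HB0]|].
      apply Rlt_le, Rinv_0_lt_compat, INR_fact_lt_0. }
    apply Rle_trans with (2 * exp B' * (A + 1) * y).
    - assert (0 <= 2 * exp B' * y) by (apply Rmult_le_pos; [generalize (exp_pos B')|]; lra).
      replace (A * (2 * exp B' * y)) with (2 * exp B' * y * A) by ring.
      replace (2 * exp B' * (A + 1) * y) with (2 * exp B' * y * A + 2 * exp B' * y) by ring.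
      lra.
    - apply Rmult_le_compat_l; lra. }
  destruct (has_mean_lim N r Fk F vk) as [v Hv]; [lra|exact Hk|exact Hu|].
  assert (forall e, 0 < e -> exists k0, forall M, (k0 <= M)%nat -> Cmod (vk M - v)%cx < e) as Hc.
  { intros e He; destruct (Hu (e / 4)) as [k0 H0]; [lra|].
    exists k0; intros M HM.
    apply Rle_lt_trans with (2 * (e / 4)); [|lra].
    apply (has_mean_dist N r (Fk M) F); auto; lra. }
  (* The [vk] are sums of real numbers, so their limit is real. *)
  assert (Im v = 0) as Hi.
  { destruct (Req_dec (Im v) 0) as [|Hn]; [assumption|exfalso].
    destruct (Hc (Rabs (Im v)) (Rabs_pos_lt _ Hn)) as [k0 H0].
    specialize (H0 k0 (le_n _)).
    generalize (Im_le_Cmod (vk k0 - v)%cx); intros H1.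
    assert (Im (vk k0) = 0) as E.
    { apply Im_Csum_RtoC. }
    change (Im (vk k0 - v)%cx) with (Im (vk k0) + - Im v) in H1.
    rewrite E, Rplus_0_l, Rabs_Ropp in H1; lra. }
  exists (Re v); split.
  - intros e He; destruct (Hc e He) as [k0 H0]; exists k0; intros M HM.
    specialize (H0 M HM); unfold Rdist.
    eapply Rle_lt_trans; [|exact H0]. eapply Rle_trans; [|apply Re_le_Cmod].
    apply Req_le; f_equal. change (Re (vk M - v)%cx) with (Re (vk M) - Re v).
    unfold vk; rewrite <- sum_f_R0_Re; reflexivity.
  - replace (RtoC (Re v)) with v by (apply C_eq; [reflexivity|exact Hi]). exact Hv.
Qed.

End Final.

Theorem theorem2 (N : nat) (q r : R) (Y : list Z) (x : Z) (t : R) :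
  (1 <= N)%nat ->
  0 < Rabs q < 1 ->
  0 < r < (1 - Rabs q) / Rabs (1 - q) ->
  in_S N Y ->
  0 <= t ->
  exists p : R,
    prob_leftmost q Y x t p /\
    contour_int N r (integrand N q Y x t) (mkC p 0).
Proof.
  intros HN Hq Hr HY _. destruct N as [|n]; [lia|].
  destruct (full_weight_mean q r Hq Hr n Y x t HY) as [p [Hp [H1 H2]]].
  exists p; split; [exact Hp|].
  generalize (two_PI_pow_pos (S n)); intros Hpi.
  set (c := / (2 * PI) ^ S n).
  split; cbv zeta.
  (* Scaling by [c] cancels the factor (2π)^N built into [has_mean]; the zero multiple only fits the
     shape of [iter_int_lin]. *)
  - apply iter_int_ext with (fun l => c *
      Re (full_weight q (S n) (exponents (S n) Y x) t (map (circ r) l)) + 0 *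
      Re (full_weight q (S n) (exponents (S n) Y x) t (map (circ r) l))).
    + intros l Hl; rewrite (integrand_eq q r Hq Hr) by exact Hl; fold c; cbn [Re Im Cmul RtoC]; ring.
    + replace (Re (mkC p 0)) with
        (c * (Re (RtoC p) * (2 * PI) ^ S n) + 0 * (Re (RtoC p) * (2 * PI) ^ S n))
        by (unfold c; simpl Re; field; lra).
      now apply iter_int_lin.
  - apply iter_int_ext with (fun l => c *
      Im (full_weight q (S n) (exponents (S n) Y x) t (map (circ r) l)) + 0 *
      Im (full_weight q (S n) (exponents (S n) Y x) t (map (circ r) l))).
    + intros l Hl; rewrite (integrand_eq q r Hq Hr) by exact Hl; fold c; cbn [Re Im Cmul RtoC]; ring.
    + replace (Im (mkC p 0)) with
        (c * (Im (RtoC p) * (2 * PI) ^ S n) + 0 * (Im (RtoC p) * (2 * PI) ^ S n))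
        by (simpl Im; ring).
      now apply iter_int_lin.
Qed.
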